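(* Let $T>0$, $p\ge1$, $\alpha\in(0,1)$, and let $f,g:\Delta\times\mathbb R^n\times U\to\mathbb R^n$ satisfy: there are nonnegative functions $K_0(\cdot)\in L^{(\frac{p}{1+\alpha p}\vee1)+}([0,T];\mathbb R)$ and $K(\cdot)\in L^{(\frac1\alpha\vee\frac{p}{p-1})+}([0,T];\mathbb R)$ such that $$|f(t,s,x,u)-f(t,s,x',u')|+|g(t,s,x,u)-g(t,s,x',u')|\le K(s)(|x-x'|+\rho(u,u'))$$ for all $(t,s)\in\Delta$, $x,x'\in\mathbb R^n$, $u,u'\in U$, and $|f(t,s,0,u)|+|g(t,s,0,u)|\le K_0(s)$ for all $(t,s)\in\Delta$, $u\in U$. Then for any $(x_0(\cdot),u(\cdot))\in L^p([0,T];\mathbb R^n)\times\mathcal U^p[0,T]$, the equation $$x(t)=x_0(t)+\int_0^t\frac{f(t,s,x(s),u(s))}{(t-s)^{1-\alpha}}\,\mathrm ds+\int_0^tg(t,s,x(s),u(s))\,\mathrm ds,\quad\text{a.e. }t\in[0,T],$$ admits a unique solution $x(\cdot;x_0,u)$ in $L^p([0,T];\mathbb R^n)$. In addition, there is a constant $C\ge0$ such that $$\|x(\cdot;x_0,u)\|_{L^p([0,T];\mathbb R^n)}\le C\bigl(1+\|x_0(\cdot)\|_{L^p([0,T];\mathbb R^n)}+\|\rho(u(\cdot),u_0)\|_{L^p([0,T];\mathbb R_+)}\bigr).$$ Furthermore, for any $x_0(\cdot),x_0'(\cdot)\in L^p([0,T];\mathbb R^n)$ and $u(\cdot),u'(\cdot)\in\mathcal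 U^p[0,T]$, there is a constant $C\ge0$ such that $$\|x(\cdot;x_0,u)-x(\cdot;x_0',u')\|_{L^p([0,T];\mathbb R^n)}\le C\|x_0(\cdot)-x_0'(\cdot)\|_{L^p([0,T];\mathbb R^n)}$$ $$+C\Bigl[\int_0^T\Bigl(\int_0^t\frac{|f(t,s,x(s;x_0,u),u(s))-f(t,s,x(s;x_0,u),u'(s))|}{(t-s)^{1-\alpha}}\,\mathrm ds\Bigr)^p\mathrm dt\Bigr]^{1/p}$$ $$+C\Bigl[\int_0^T\Bigl(\int_0^t|g(t,s,x(s;x_0,u),u(s))-g(t,s,x(s;x_0,u),u'(s))|\,\mathrm ds\Bigr)^p\mathrm dt\Bigr]^{1/p}.$$
   Context: $\Delta:=\{(t,s)\in[0,T]^2:0\le s\le t\le T\}$; $a\vee b:=\max\{a,b\}$; $L^{q+}:=\bigcup_{r>q}L^r$ for $1\le q<\infty$. When $p=1$, $\frac{p}{p-1}$ is read as $\infty$ and the condition on $K$ means $K(\cdot)\in L^\infty([0,T];\mathbb R)$. $U\subset\mathbb R^d$ and $(U,\rho)$ is a separable metric space with $\rho(u,u')=|u-u'|$. For a fixed $u_0\in U$, $\mathcal U^p[0,T]$ is the set of measurable $u:[0,T]\to U$ with $\rho(u(\cdot),u_0)\in L^p([0,T];\mathbb R_+)$. The functions $f,g$ are measurable so that the integrals are meaningful. *)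

(* Defs.v *)
From HB Require Import structures.
From mathcomp Require Import all_boot all_order all_algebra.
From mathcomp Require Import all_classical all_reals all_analysis.

Set Implicit Arguments.
Unset Strict Implicit.
Unset Printing Implicit Defensive.

Import Order.TTheory GRing.Theory Num.Theory.
Import numFieldNormedType.Exports.

Local Open Scope classical_set_scope.
Local Open Scope ring_scope.

(* The sigma-algebra generated by the coordinates, as the library does for
   [n.-tuple T]; for T = R it is the Borel sigma-algebra of R^n. *)
Definition measure_rV_display : measure_display -> measure_display.
Proof. exact. Qed.

Section measurable_rV.
Context {d} {T : measurableType d}.
Variable n : nat.

Let coors : 'I_n -> 'rV[T]_n -> T := fun i x => x ord0 i.

Let rV_set0 : g_sigma_preimage coors set0.
Proof. exact: sigma_algebra0. Qed.

Let rV_setC A : g_sigma_preimage coors A -> g_sigma_preimage coors (~` A).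
Proof. exact: sigma_algebraC. Qed.

Let rV_bigcup (F : _^nat) : (forall i, g_sigma_preimage coors (F i)) ->
  g_sigma_preimage coors (\bigcup_i (F i)).
Proof. exact: sigma_algebra_bigcup. Qed.

HB.instance Definition _ := @isMeasurable.Build (measure_rV_display d)
  'rV[T]_n (g_sigma_preimage coors) rV_set0 rV_setC rV_bigcup.

End measurable_rV.

(* [measurable_fun D f] is vacuous when D is not measurable, which may happen
   here because the control set U is arbitrary: this is measurability for the
   sigma-algebra induced on D. *)
Definition trace_measurable d d' (X : measurableType d) (Y : measurableType d')
    (D : set X) (f : X -> Y) :=
  forall B, measurable B -> strace measurable D (D `&` f @^-1` B).

Section volterra.
Context {R : realType}.
Implicit Types (T p alpha t : R) (q : \bar R) (h : R -> R).

Local Notation mu := (@lebesgue_measure R).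

(* The norm of the library on 'rV[R]_n is the sup norm. *)
Definition enorm n (x : 'rV[R]_n) : R := Num.sqrt (\sum_i x ord0 i ^+ 2).

(* Functions on [0, T] are functions on R of which only the restriction to
   [0, T] matters; [h \_ `[0, T]] is h extended by 0 outside [0, T]. *)
Definition in_Lp T q h : Prop := h \_ `[0, T] \in Lfun mu q.

Definition Lp_norm T q h : \bar R := ('N[mu]_q [EFin \o (h \_ `[0%R, T])%R])%E.

(* L^{q+}, read as L^oo when q = +oo. *)
Definition in_Lplus T q h : Prop :=
  if q is r%:E then exists2 r', r < r' & in_Lp T r'%:E h else in_Lp T +oo h.

Definition in_LpV n T p (x : R -> 'rV[R]_n) : Prop :=
  measurable_fun `[0, T] x /\ in_Lp T p%:E (fun t => enorm (x t)).

Definition LpV_norm n T p (x : R -> 'rV[R]_n) : \bar R :=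
  Lp_norm T p%:E (fun t => enorm (x t)).

Definition admissible_control d (U : set 'rV[R]_d) (u0 : 'rV[R]_d) T p
    (u : R -> 'rV[R]_d) : Prop :=
  [/\ measurable_fun `[0, T] u,
      forall t : R, t \in `[0, T] -> U (u t) &
      in_Lp T p%:E (fun t => enorm (u t - u0))].

Definition triangle T : set (R * R) :=
  [set ts | 0 <= ts.2 /\ ts.2 <= ts.1 /\ ts.1 <= T].

Definition measurable_coef n d (U : set 'rV[R]_d) T
    (f : R -> R -> 'rV[R]_n -> 'rV[R]_d -> 'rV[R]_n) : Prop :=
  trace_measurable (triangle T `*` [set: 'rV[R]_n] `*` U)
    (fun z => f z.1.1.1 z.1.1.2 z.1.2 z.2).

Definition vintegrable n (D : set R) (F : R -> 'rV[R]_n) : Prop :=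
  forall i, mu.-integrable D (fun s => (F s ord0 i)%:E).

Definition vintegral n (D : set R) (F : R -> 'rV[R]_n) : 'rV[R]_n :=
  \row_i \int[mu]_(s in D) F s ord0 i.

(* The junk value taken by [singular_term] at s = t is irrelevant to integrals
   in s. *)
Definition singular_term n d alpha
    (f : R -> R -> 'rV[R]_n -> 'rV[R]_d -> 'rV[R]_n)
    (x : R -> 'rV[R]_n) (u : R -> 'rV[R]_d) t (s : R) : 'rV[R]_n :=
  ((t - s) `^ (1 - alpha))^-1 *: f t s (x s) (u s).

Definition regular_term n d
    (g : R -> R -> 'rV[R]_n -> 'rV[R]_d -> 'rV[R]_n)
    (x : R -> 'rV[R]_n) (u : R -> 'rV[R]_d) t (s : R) : 'rV[R]_n :=
  g t s (x s) (u s).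

(* [vintegral] is total, so the existence of both integrals is required. *)
Definition Lp_solution n d T p alpha
    (f g : R -> R -> 'rV[R]_n -> 'rV[R]_d -> 'rV[R]_n)
    (x0 : R -> 'rV[R]_n) (u : R -> 'rV[R]_d) (x : R -> 'rV[R]_n) : Prop :=
  in_LpV T p x /\
  {ae mu, forall t : R, t \in `[0, T] ->
    [/\ vintegrable `[0, t] (singular_term alpha f x u t),
        vintegrable `[0, t] (regular_term g x u t) &
        x t = x0 t + vintegral `[0, t] (singular_term alpha f x u t)
                   + vintegral `[0, t] (regular_term g x u t)]}.

End volterra.

(* Main.v *)
(* On (0, T] both kernels are dominated by k(r) = r^(alpha - 1) + 1, so the
   equation is controlled by the linear operator A h(t) = \int_0^t k(t - s) K(s)
   h(s) ds. By Young's inequality A is bounded on L^p, and its norm for the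
   weighted measure exp(- lam p t) dt tends to 0 as lam goes to infinity,
   because the L^m norm of exp(- lam r) k(r) does, m being the conjugate
   exponent of the one of K. This gives a Gronwall inequality in L^p: a bound
   z <= e + c A z almost everywhere implies a bound of the norm of z by that
   of e. Stability, uniqueness and the a priori bound are instances of it. For
   existence, applied to the partial sums of |x_(j+1) - x_j| along the Picard
   iteration it bounds them in L^p uniformly, so the iterates converge almost
   everywhere and, by dominated convergence, in L^p. *)
Require Import Defs.
From HB Require Import structures.
From mathcomp Require Import all_boot all_order all_algebra.
From mathcomp Require Import all_classical all_reals all_analysis.
From mathcomp Require Import measurable_realfun ess_sup_inf ring lra.

Set Implicit Arguments.
Unset Strict Implicit.
Unset Printing Implicit Defensive.

Import Order.TTheory GRing.Theory Num.Theory.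
Import numFieldNormedType.Exports.

Local Open Scope classical_set_scope.
Local Open Scope ring_scope.

(** * Translation-invariant integrals and Young's inequality on the line *)

Section convolution.
Context {R : realType}.
Local Notation mu := (@lebesgue_measure R).

(** A small operator norm only gives z <= e + half of z in the weighted norm, and subtracting that
    half requires the norm of z to be finite beforehand. Hence the Picard map is shown to preserve
    L^p, and the Gronwall inequality is applied to finite partial sums, with a bound independent of
    their length. The strict condition on K makes the kernel small: a coefficient in L^q with q >
    1/alpha leaves for k the conjugate exponent m with (1 - alpha) m < 1, for which k^m is
    integrable at 0; the condition q >= p/(p - 1) says m <= p, as Young's inequality demands. The
    condition on K0 places the convolution of k and K0 in L^p. Volterra integrals are written as
    convolutions on the whole line, all functions being extended by 0 outside [0, T]; k then
    vanishes at negative arguments, so causality is built in. Norms enter through integrals of p-th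
    powers, and (x + y)^p <= 2^p (x^p + y^p) replaces Minkowski's inequality; roots are taken only
    at the end. Powers of c = n + 1 come from a triangle inequality with a constant. *)

#[export] Instance ae_filter_lebesgue : Filter (almost_everywhere mu).
Proof. typeclasses eauto. Qed.

Lemma ae_le_integral (f g : R -> \bar R) (D : set R) : measurable D ->
  (forall x, D x -> 0 <= f x)%E -> measurable_fun D f ->
  (forall x, D x -> 0 <= g x)%E -> measurable_fun D g ->
  {ae mu, forall x, D x -> (f x <= g x)%E} ->
  (\int[mu]_(x in D) f x <= \int[mu]_(x in D) g x)%E.
Proof. by move=> mD f0 mf g0 mg; exact: ae_ge0_le_integral. Qed.

(** Uniqueness of the Lebesgue measure: its image under a translation still gives each half-open
    interval its length. *)
Lemma ge0_integral_translation (f : R -> \bar R) (c : R) :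
  measurable_fun [set: R] f -> (forall x, 0 <= f x)%E ->
  (\int[mu]_x f (x - c)%R = \int[mu]_x f x)%E.
Proof.
move=> mf f0.
pose phi : measurableTypeR R -> measurableTypeR R := fun x => x - c.
have mphi : measurable_fun setT phi by exact: measurable_funB.
rewrite -(@ge0_integral_pushforward _ _ _ _ _ phi mphi mu setT f)//.
apply: eq_measure_integral => A mA _.
apply/esym/(@lebesgue_measure_unique _ (pushforward mu phi)) =>
  //= _ [[a b]] _ <-.
rewrite /pushforward; set B := _ @^-1` _.
have -> : B = `]a + c, b + c]%classic.
  apply/seteqP; split=> x; rewrite /B /phi /= !in_itv/= ltrBrDr lerBlDr//.
rewrite !lebesgue_measure_itv/= !lte_fin ltrD2r.
by case: ifPn => // _; rewrite -!EFinB opprD addrACA subrr addr0.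
Qed.

Lemma ge0_integral_reflection (f : R -> \bar R) (c : R) :
  measurable_fun [set: R] f -> (forall x, 0 <= f x)%E ->
  (\int[mu]_x f (c - x)%R = \int[mu]_x f x)%E.
Proof.
move=> mf f0.
pose phi : measurableTypeR R -> measurableTypeR R := fun x => c - x.
have mphi : measurable_fun setT phi by exact: measurable_funB.
rewrite -(@ge0_integral_pushforward _ _ _ _ _ phi mphi mu setT f)//.
apply: eq_measure_integral => A mA _.
apply/esym/(@lebesgue_measure_unique _ (pushforward mu phi)) =>
  //= _ [[a b]] _ <-.
rewrite /pushforward; set B := _ @^-1` _.
have -> : B = `[c - b, c - a[%classic.
  apply/seteqP; split=> x; rewrite /B /phi /= !in_itv/=; lra.
rewrite !lebesgue_measure_itv/= !lte_fin ltrD2l ltrN2.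
by case: ifPn => // _; rewrite -!EFinB; congr EFin; ring.
Qed.

Lemma measurable_fun_shift (f : R -> R) (c : R) :
  measurable_fun [set: R] f -> measurable_fun setT (fun s : R => f (c - s)).
Proof.
by move=> mf; apply: (measurableT_comp mf); exact: measurable_funB.
Qed.

Lemma measurable_fun_sub2 (f : R -> R) : measurable_fun [set: R] f ->
  measurable_fun [set: R * R] (fun z => f (z.1 - z.2)).
Proof.
by move=> mf; apply: (measurableT_comp mf); apply: measurable_funB.
Qed.

Lemma measurable_integral2 (F : R -> R -> \bar R) :
  measurable_fun [set: R * R] (fun z => F z.1 z.2) ->
  (forall t s, 0 <= F t s)%E ->
  measurable_fun [set: R] (fun t => \int[mu]_s F t s)%E.
Proof.
move=> mF F0; apply: (@measurable_fun_fubini_tonelli_F _ _ _ _ _ mu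
  (fun z : R * R => F z.1 z.2)) => // z; exact: F0.
Qed.

(** Tonelli, then translation invariance in the inner integral. This is Young's inequality for p =
    1, and it also integrates the first Hoelder factor when p > 1. *)
Lemma integral_convolution (f h : R -> R) :
  measurable_fun [set: R] f -> (forall x, 0 <= f x) ->
  measurable_fun [set: R] h -> (forall x, 0 <= h x) ->
  (\int[mu]_t \int[mu]_s (f (t - s) * h s)%:E =
   (\int[mu]_t (f t)%:E) * (\int[mu]_s (h s)%:E))%E.
Proof.
move=> mf f0 mh h0.
have /= -> := @fubini_tonelli _ _ _ _ R mu mu
  (fun z : R * R => (f (z.1 - z.2) * h z.2)%:E); first last.
- by move=> z; rewrite lee_fin mulr_ge0.
- apply/measurable_EFinP/measurable_funM; first exact: measurable_fun_sub2.
  exact: measurableT_comp.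
rewrite -ge0_integralZl//; first last.
- by apply: integral_ge0 => x _; rewrite lee_fin.
- by move=> x _; rewrite lee_fin.
- exact/measurable_EFinP.
apply: eq_integral => s _.
under eq_integral do rewrite EFinM muleC.
rewrite ge0_integralZl//; first last.
- by rewrite lee_fin.
- by move=> x _; rewrite lee_fin.
- apply/measurable_EFinP; apply: (measurableT_comp mf).
  exact: measurable_funB.
rewrite (@ge0_integral_translation (EFin \o f))//; first by rewrite muleC.
exact/measurable_EFinP.
Qed.

(** Both bases are at most max(a, b) and the exponents sum to 1. A crude weighted inequality of
    arithmetic and geometric means. *)
Lemma powR_mul_leD (a b x y : R) : 0 <= a -> 0 <= b -> 0 <= x -> 0 <= y ->
  x + y = 1 -> a `^ x * b `^ y <= a + b.
Proof.
move=> a0 b0 x0 y0 xy; set c := Num.max a b.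
have ac : a <= c by rewrite le_max lexx.
have bc : b <= c by rewrite le_max lexx orbT.
have c0 : 0 <= c := le_trans a0 ac.
apply: (@le_trans _ _ (c `^ x * c `^ y)).
  by apply: ler_pM; rewrite ?powR_ge0// ge0_ler_powR// nnegrE.
rewrite -powRD; last by rewrite xy oner_eq0.
rewrite xy powRr1// ge_max.
by apply/andP; split; lra.
Qed.

(** Hoelder's inequality raised to the power p, so that no root remains: the exponent p/q of the
    second integral is p - 1. *)
Lemma hoelder_ge0 (f g : R -> R) (p q : R) :
  measurable_fun [set: R] f -> measurable_fun [set: R] g ->
  (forall x, 0 <= f x) -> (forall x, 0 <= g x) ->
  1 < p -> q = p / (p - 1) ->
  ((\int[mu]_x (f x * g x)%:E) `^ p <=
   (\int[mu]_x (f x `^ p)%:E) * (\int[mu]_x (g x `^ q)%:E) `^ (p - 1))%E.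
Proof.
move=> mf mg f0 g0 p1 qE.
have p0 : 0 < p by lra.
have pB0 : 0 < p - 1 by lra.
have q0 : 0 < q by rewrite qE divr_gt0.
have pq : p^-1 + q^-1 = 1 by rewrite qE; field; lra.
have /(@gt0_ler_poweR R p (ltW p0)) := @hoelder _ _ _ mu f g p q mf mg p0 q0 pq.
rewrite !in_itv/= !leey !andbT !Lnorm_ge0 mule_ge0 ?Lnorm_ge0//.
move=> /(_ isT isT).
have -> : ('N[mu]_1[EFin \o (f \* g)%R] = \int[mu]_x (f x * g x)%:E)%E.
  rewrite Lnorm1; apply: eq_integral => x _ /=.
  by rewrite ger0_norm// mulr_ge0.
move=> /le_trans; apply.
rewrite poweRM ?Lnorm_ge0// unlock /Lnorm.
rewrite -!poweRrM mulVf ?gt_eqF//.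
rewrite [X in (X * _)%E]poweRe1; last by apply: integral_ge0 => x _;
  rewrite poweR_ge0.
have -> : q^-1 * p = p - 1 by rewrite qE; field; lra.
have H (h : R -> R) r : (forall x, 0 <= h x) ->
    (\int[mu]_x `|(EFin \o h) x| `^ r = \int[mu]_x (h x `^ r)%:E)%E.
  by move=> h0; apply: eq_integral => x _ /=; rewrite ger0_norm.
by rewrite !H.
Qed.

(* Hoelder's inequality for [phi^(m/p) h] and [phi^(1 - m/p) k]; as
   [(phi^(1 - m/p) k)^(p/(p-1)) <= phi^m + k^q], its second factor is bounded
   independently of [t]. *)
Lemma convolution_pnorm (phi k h : R -> R) (p m q : R) :
  measurable_fun [set: R] phi -> (forall x, 0 <= phi x) ->
  measurable_fun [set: R] k -> (forall x, 0 <= k x) ->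
  measurable_fun [set: R] h -> (forall x, 0 <= h x) ->
  1 < p -> 0 < m -> 0 < q -> m^-1 + q^-1 = 1 -> q^-1 <= 1 - p^-1 ->
  (\int[mu]_t (\int[mu]_s (phi (t - s) * k s * h s)%:E) `^ p <=
   (\int[mu]_t (phi t `^ m)%:E + \int[mu]_s (k s `^ q)%:E) `^ (p - 1) *
   ((\int[mu]_t (phi t `^ m)%:E) * (\int[mu]_s (h s `^ p)%:E)))%E.
Proof.
move=> mphi phi0 mk k0 mh h0 p1 m0 q0 mq qp.
have p0 : 0 < p by lra.
have pB0 : 0 < p - 1 by lra.
have mpow (f : R -> R) r : measurable_fun [set: R] f ->
    measurable_fun setT (fun x : R => f x `^ r).
  by move=> mf; apply: (measurableT_comp (measurable_powR _)).
rewrite -(@integral_convolution (fun x => phi x `^ m) (fun x => h x `^ p));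
  try by [exact: mpow | move=> x; exact: powR_ge0].
set M := ((_ + _) `^ (p - 1))%E.
have mI2 : measurable_fun [set: R * R]
    (fun z => (phi (z.1 - z.2) `^ m * h z.2 `^ p)%:E).
  apply/measurable_EFinP/measurable_funM.
    by apply: (@measurable_fun_sub2 (fun x => phi x `^ m)); exact: mpow.
  by apply: (@measurableT_comp _ _ _ _ _ _ (fun x => h x `^ p)) => //;
    exact: mpow.
rewrite -ge0_integralZl//; first last.
- exact: poweR_ge0.
- by move=> t _; apply: integral_ge0 => s _; rewrite lee_fin mulr_ge0 ?powR_ge0.
- apply: (@measurable_integral2 (fun t s =>
  (phi (t - s) `^ m * h s `^ p)%:E)) => //.
  by move=> t s; rewrite lee_fin mulr_ge0 ?powR_ge0.
apply: ge0_le_integral => //.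
- by move=> t _; exact: poweR_ge0.
- apply: (measurableT_comp (measurable_poweR _)).
  apply: (@measurable_integral2 (fun t s => (phi (t - s) * k s * h s)%:E)) =>
    //.
    apply/measurable_EFinP/measurable_funM; last exact: measurableT_comp.
    by apply: measurable_funM;
      [exact: measurable_fun_sub2|exact: measurableT_comp].
  by move=> ? ?; rewrite lee_fin !mulr_ge0.
- apply: emeasurable_funM => //.
  apply: (@measurable_integral2 (fun t s =>
    (phi (t - s) `^ m * h s `^ p)%:E)) => //.
  by move=> t s; rewrite lee_fin mulr_ge0 ?powR_ge0.
move=> t _.
pose F s := phi (t - s) `^ (m / p) * h s.
pose G s := phi (t - s) `^ (1 - m / p) * k s.
have mpt : measurable_fun setT (fun s : R =>
  phi (t - s)) by exact: measurable_fun_shift.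
have mF : measurable_fun setT F by apply: measurable_funM => //; exact: mpow.
have mG : measurable_fun setT G by apply: measurable_funM => //; exact: mpow.
have F0 s : 0 <= F s by rewrite mulr_ge0 ?powR_ge0.
have G0 s : 0 <= G s by rewrite mulr_ge0 ?powR_ge0.
have -> : (\int[mu]_s (phi (t - s) * k s * h s)%:E =
           \int[mu]_s (F s * G s)%:E)%E.
  apply: eq_integral => s _; rewrite /F /G mulrACA -powRD; last first.
    by rewrite addrC subrK oner_eq0.
  by rewrite [_ + (1 - _)]addrC subrK powRr1// -mulrA (mulrC (h s)).
have /le_trans := hoelder_ge0 mF mG F0 G0 p1 erefl; apply.
rewrite muleC.
have -> : (\int[mu]_s (F s `^ p)%:E =
           \int[mu]_s (phi (t - s) `^ m * h s `^ p)%:E)%E.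
  apply: eq_integral => s _; rewrite /F powRM ?powR_ge0// -powRrM.
  by rewrite divfK ?gt_eqF.
apply: lee_wpmul2r.
  by apply: integral_ge0 => s _; rewrite lee_fin mulr_ge0 ?powR_ge0.
have I0 (f : R -> R) r : (0 <= \int[mu]_x (f x `^ r)%:E)%E.
  by apply: integral_ge0 => x _; rewrite lee_fin powR_ge0.
apply: gt0_ler_poweR; [exact: ltW | by rewrite in_itv/= leey andbT I0 | |].
  by rewrite in_itv/= leey andbT; apply: adde_ge0; exact: I0.
rewrite -(@ge0_integral_reflection (fun x => (phi x `^ m)%:E) t); first last.
- by move=> x; rewrite lee_fin powR_ge0.
- by apply/measurable_EFinP; exact: mpow.
rewrite -ge0_integralD//; first last.
- by apply/measurable_EFinP; exact: mpow.
- by move=> x _; rewrite lee_fin powR_ge0.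
- by apply/measurable_EFinP; apply: (mpow (fun s => phi (t - s))).
- by move=> x _; rewrite lee_fin powR_ge0.
apply: ge0_le_integral => //.
- by move=> x _; rewrite lee_fin powR_ge0.
- by apply/measurable_EFinP; exact: mpow.
- apply/measurable_EFinP; apply: measurable_funD; last exact: mpow.
  exact: (mpow (fun s => phi (t - s))).
move=> s _; rewrite -EFinD lee_fin /G powRM ?powR_ge0// -powRrM.
(* The weights for [powR_mul_leD] are (1/m - 1/p) p' and p'/q. They sum to 1 because 1/m + 1/q = 1
   and (1 - 1/p) p' = 1; the first is nonnegative because 1/q <= 1 - 1/p. *)
set p' := p / (p - 1).
have p'0 : 0 < p' by rewrite divr_gt0.
have -> : (1 - m / p) * p' = m * ((m^-1 - p^-1) * p').
  by field; rewrite ?gt_eqF.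
have -> : p' = q * (p' / q) by field; rewrite ?gt_eqF.
rewrite -[q * (p' / q) in X in _ `^ X * _]mulrC divfK ?gt_eqF//.
rewrite (powRrM _ m) (powRrM _ q); apply: powR_mul_leD; rewrite ?powR_ge0//.
- by apply: mulr_ge0; [lra | exact: ltW].
- by rewrite divr_ge0// ltW.
have -> : m^-1 = 1 - q^-1 by lra.
by rewrite /p'; field; rewrite !gt_eqF.
Qed.

End convolution.

(** * The singular kernel and its exponential damping *)

Section skernel.
Context {R : realType}.
Local Notation mu := (@lebesgue_measure R).

(** The fundamental theorem of calculus is applied away from the singularity, on [T/(n+2), T], where
    the value of the primitive at T bounds every integral; monotone convergence reaches ]0, T]. *)
Lemma integral_powRN_itvoc (b T : R) : 0 < T -> b < 1 ->
  (\int[mu]_(t in `]0%R, T]) (t `^ (- b))%:E < +oo)%E.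
Proof.
move=> T0 b1.
pose F (t : R) := t `^ (1 - b) / (1 - b).
have b1' : 1 - b != 0 by rewrite subr_eq0 gt_eqF.
have dF (x : R) : 0 < x -> is_derive x 1 F (x `^ (- b)).
  move=> x0; rewrite /F.
  have -> : (fun t : R => t `^ (1 - b) / (1 - b)) =
            (1 - b)^-1 *: (fun t : R => t `^ (1 - b)).
    by apply/funext => t /=; rewrite mulrC.
  have := is_derive1_powR (1 - b) x0 => df.
  apply: is_derive_eq; rewrite /GRing.scale/= mulrA mulVf// mul1r.
  by congr (_ `^ _); ring.
have cF (x : R) : 0 < x -> {for x, continuous F}.
  move=> x0; apply/differentiable_continuous/derivable1_diffP.
  by have [] := dF x x0.
(* With [n.+2] the left endpoint is strictly smaller than T already at n = 0. *)
pose a n : R := T / n.+2%:R.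
have a0 n : 0 < a n by rewrite divr_gt0.
have aT n : a n < T by rewrite ltr_pdivrMr// ltr_pMr// ltr1n.
have intE n : (\int[mu]_(t in `[a n,
  T]) (t `^ (- b))%:E = (F T)%:E - (F (a n))%:E)%E.
  apply: continuous_FTC2 => //.
  - apply: derivable_within_continuous => x; rewrite in_itv/= => /andP[ax _].
    by apply: derivable_powR; rewrite in_itv/= andbT (lt_le_trans (a0 n)).
  - split.
    + move=> x; rewrite in_itv/= => /andP[ax _].
      by have [] := dF x (lt_trans (a0 n) ax).
    + by apply: cvg_at_right_filter; exact: cF.
    + by apply: cvg_at_left_filter; exact: cF.
  - move=> x; rewrite in_itv/= => /andP[ax _].
    rewrite derive1E; apply: derive_val; exact: dF (lt_trans (a0 n) ax).
have aE : `]0, T]%classic = \bigcup_n `[a n, T]%classic.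
  apply/seteqP; split => x.
    rewrite /= in_itv/= => /andP[x0 xT].
    have [n nx] : exists n : nat, T / x < n%:R.
      by exists (Num.bound (T / x)); apply: archi_boundP;
        rewrite divr_ge0// ltW.
    exists n => //=; rewrite in_itv/= xT andbT /a ler_pdivrMr//.
    move: nx; rewrite ltr_pdivrMr// => /ltW /le_trans; apply.
    by rewrite mulrC ler_pM2l// ler_nat leqW.
  move=> [n _]; rewrite /= !in_itv/= => /andP[ax ->].
  by rewrite andbT (lt_le_trans (a0 n)).
have mp : measurable_fun [set: R] (fun t => (t `^ (- b))%:E).
  exact/measurable_EFinP.
have cvgI : (\int[mu]_(t in `[a n, T]) (t `^ (- b))%:E @[n --> \oo] -->
    \int[mu]_(t in `]0%R, T]) (t `^ (- b))%:E)%E.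
  rewrite aE; apply: ge0_nondecreasing_set_cvg_integral => //.
  - move=> i j ij; rewrite subsetEset; apply: subset_itvr; rewrite bnd_simp.
    by rewrite ler_pM2l// lef_pV2 ?posrE// ler_nat.
  - by move=> n; exact: measurable_funTS.
  - by move=> n x _; rewrite lee_fin powR_ge0.
apply: (@le_lt_trans _ _ (F T)%:E); last exact: ltry.
rewrite -(cvg_lim _ cvgI)//; apply: lime_le; first by apply/cvg_ex; eexists;
  exact: cvgI.
apply: nearW => n; rewrite intE -EFinB lee_fin lerBlDr lerDl.
by rewrite divr_ge0 ?powR_ge0// subr_ge0 ltW.
Qed.

(* The junk value at 0 is irrelevant. *)
Definition skernel (alpha T : R) : R -> R :=
  (fun t => (t `^ (1 - alpha))^-1 + 1) \_ `[0, T].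

Lemma skernel_ge0 alpha T t : 0 <= skernel alpha T t.
Proof.
by rewrite /skernel patchE; case: ifP => // _;
  rewrite addr_ge0// invr_ge0 powR_ge0.
Qed.

Lemma measurable_skernel alpha T : measurable_fun [set: R] (skernel alpha T).
Proof.
apply/(measurable_restrictT _ _).1 => //; apply: measurable_funTS.
apply: measurable_funD => //.
under eq_fun do rewrite -powRN.
exact: measurable_powR.
Qed.

Definition damped (lam : R) (k : R -> R) (t : R) :
  R := expR (- (lam * t)) * k t.

Lemma measurable_damped lam (k : R -> R) : measurable_fun [set: R] k ->
  measurable_fun [set: R] (damped lam k).
Proof.
move=> mk; apply: measurable_funM => //; apply: measurableT_comp => //.
by apply: measurableT_comp => //; exact: measurable_funM.
Qed.

Lemma damped_ge0 lam (k : R -> R) t :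
  (forall t, 0 <= k t) -> 0 <= damped lam k t.
Proof. by move=> k0; rewrite mulr_ge0 ?expR_ge0. Qed.

(** The damped kernels tend to 0 at every t > 0 and are all dominated by a multiple of t^(-(1 -
    alpha) m), integrable at 0 because (1 - alpha) m < 1. Dominated convergence does the rest. *)
Lemma skernel_pow_small (alpha T m : R) : 0 < alpha -> alpha < 1 -> 0 < T ->
  1 <= m -> (1 - alpha) * m < 1 ->
  (\int[mu]_t (skernel alpha T t `^ m)%:E < +oo)%E /\
  (forall e : R, (0 < e)%R -> exists n : nat,
    \int[mu]_t (damped n%:R (skernel alpha T) t `^ m)%:E <= e%:E)%E.
Proof.
move=> al0 al1 T0 m1 am.
have m0 : 0 < m by lra.
(* On ]0, T] one has 1 <= T^(1 - alpha) t^(alpha - 1), so the kernel is at most (1 + T^(1 - alpha))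
   t^(alpha - 1). *)
pose C := (1 + T `^ (1 - alpha)) `^ m.
pose g (t : R) := (C * t `^ (- ((1 - alpha) * m)))%:E.
have kg t : `]0, T]%classic t -> ((skernel alpha T t `^ m)%:E <= g t)%E.
  rewrite /= in_itv/= => /andP[t0 tT].
  rewrite lee_fin /skernel patchE mem_set; last by rewrite /= in_itv/= (ltW t0).
  have -> : - ((1 - alpha) * m) = (- (1 - alpha)) * m by rewrite mulNr.
  rewrite powRrM /C -powRM ?powR_ge0//; last by rewrite addr_ge0// powR_ge0.
  apply: ge0_ler_powR; rewrite ?nnegrE ?(ltW m0)//.
  - by rewrite addr_ge0// invr_ge0 powR_ge0.
  - by rewrite mulr_ge0 ?powR_ge0// addr_ge0// powR_ge0.
  rewrite powRN mulrDl mul1r lerD2l -ler_pdivrMr ?invr_gt0 ?powR_gt0//.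
  by rewrite invrK mul1r ge0_ler_powR// ?nnegrE; lra.
have ig : mu.-integrable `]0, T] g.
  have -> : g = (fun t => C%:E * (t `^ (- ((1 - alpha) * m)))%:E)%E.
    by apply/funext => t; rewrite -EFinM.
  apply: integrableZl => //; apply/integrableP; split.
    by apply/measurable_EFinP; exact: measurable_funTS.
  under eq_integral do rewrite gee0_abs ?lee_fin ?powR_ge0//.
  exact: integral_powRN_itvoc.
have md n : measurable_fun [set: R] (fun t =>
  (damped n (skernel alpha T) t `^ m)%:E).
  apply/measurable_EFinP; apply: (measurableT_comp (measurable_powR _)).
  by apply: measurable_damped; exact: measurable_skernel.
(* The point 0 must be removed: there the majorant [g] has the default value 0 of a power of 0,
   while the kernel is 1. *)
have toitv n : (\int[mu]_t (damped n (skernel alpha T) t `^ m)%:E =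
    \int[mu]_(t in `]0%R, T]) (damped n (skernel alpha T) t `^ m)%:E)%E.
  rewrite integral_itv_obnd_cbnd; last exact: measurable_funTS.
  rewrite [RHS]integral_mkcond; apply: eq_integral => t _.
  rewrite [RHS]patchE; case: ifPn => // tT.
  by rewrite /damped /skernel patchE (negbTE tT) mulr0 powR0// gt_eqF.
have dE n t : damped n (skernel alpha T) t `^ m =
    expR (- (n * t * m)) * skernel alpha T t `^ m.
  by rewrite /damped powRM ?expR_ge0 ?skernel_ge0// -expRM mulNr.
have dle n t : 0 <= n -> `]0, T]%classic t ->
   ((damped n (skernel alpha T) t `^ m)%:E <= g t)%E.
  move=> n0 tT; apply: le_trans (kg t tT); rewrite lee_fin dE.
  rewrite ler_piMl ?powR_ge0// -expR0 ler_expR oppr_le0.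
  by move: tT; rewrite /= in_itv/= => /andP[/ltW t0 _];
    rewrite !mulr_ge0 ?(ltW m0).
split.
  have -> : (\int[mu]_t (skernel alpha T t `^ m)%:E =
     \int[mu]_t (damped 0 (skernel alpha T) t `^ m)%:E)%E.
    by apply: eq_integral => t _; rewrite dE !mul0r oppr0 expR0 mul1r.
  rewrite toitv; apply: (@le_lt_trans _ _ (\int[mu]_(t in `]0%R, T]) g t)%E).
    apply: ge0_le_integral => //.
    - by move=> x _; rewrite lee_fin powR_ge0.
    - exact: (measurable_funTS (md 0)).
    - by case/integrableP: ig.
    - by move=> t tT; exact: dle.
  by apply: integrable_lty.
move=> e e0.
pose f_ n t := (damped n%:R (skernel alpha T) t `^ m)%:E.
have cvgf : {ae mu, forall t, `]0, T]%classic t -> f_ n t @[n --> \oo] --> 0%E}.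
  apply: aeW => t; rewrite /= in_itv/= => /andP[t0 _].
  apply: cvg_EFin; first exact: nearW.
  rewrite /comp/= -(mul0r (skernel alpha T t `^ m)).
  under eq_fun do rewrite dE.
  apply: cvgMl.
  have -> : (fun n : nat => expR (- (n%:R * t * m))) =
            (fun n : nat => expR (- (t * m)) ^+ n).
    apply/funext => n; rewrite -expRM_natl; congr expR; ring.
  apply: cvg_expr; rewrite ger0_norm ?expR_ge0// -expR0 ltr_expR oppr_lt0.
  exact: mulr_gt0.
have bndf : {ae mu, forall t n, `]0, T]%classic t -> (`|f_ n t| <= g t)%E}.
  apply: aeW => t n tT; rewrite gee0_abs ?lee_fin ?powR_ge0//.
  exact: dle.
have mf_ n : measurable_fun `]0,
  T] (f_ n) by exact: (measurable_funTS (md n%:R)).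
have mitv : measurable (`]0, T]%classic : set (measurableTypeR R)).
  exact: measurable_itv.
have [_ _] := @dominated_convergence _ _ _ mu _ mitv f_ (fun=> 0%E) g mf_
  (measurable_cst _) cvgf ig bndf.
rewrite integral0 => /fine_cvgP[finI /cvgrPdist_le/(_ e e0) cvgI].
near \oo => n; exists n.
have fn : (\int[mu]_(t in `]0%R, T]) f_ n t \is a fin_num)%E by near: n.
rewrite toitv -[leLHS](fineK fn) lee_fin.
have : `|0 - fine (\int[mu]_(t in `]0%R, T]) f_ n t)%E| <= e by near: n.
by rewrite sub0r normrN; apply: le_trans; exact: ler_norm.
Unshelve. all: by end_near. Qed.

End skernel.

(** * Smoothing estimates and the Gronwall inequality in L^p *)

Section gronwall.
Context {R : realType}.
Local Notation mu := (@lebesgue_measure R).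

(** Valued in the extended reals, so that it makes sense for nonnegative functions before any
    integrability is known. *)
Definition convolution (k w : R -> R) (t : R) : \bar R :=
  (\int[mu]_s (k (t - s) * w s)%:E)%E.

Lemma convolution_ge0 (k w : R -> R) t :
  (forall x, 0 <= k x) -> (forall x, 0 <= w x) -> (0 <= convolution k w t)%E.
Proof.
by move=> k0 w0; apply: integral_ge0 => s _; rewrite lee_fin mulr_ge0.
Qed.

Lemma measurable_convolution (k w : R -> R) :
  measurable_fun [set: R] k -> (forall x, 0 <= k x) ->
  measurable_fun [set: R] w -> (forall x, 0 <= w x) ->
  measurable_fun [set: R] (convolution k w).
Proof.
move=> mk k0 mw w0.
apply: (@measurable_integral2 _ (fun t s => (k (t - s) * w s)%:E)).
  apply/measurable_EFinP/measurable_funM; first exact: measurable_fun_sub2.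
  exact: measurableT_comp.
by move=> t s; rewrite lee_fin mulr_ge0.
Qed.

(** The weight is multiplicative: exp(-lam t) = exp(-lam (t - s)) exp(-lam s). Damping the output
    therefore amounts to damping both the kernel and the input. *)
Lemma damped_convolution lam (k K h : R -> R) t :
  measurable_fun [set: R] k -> (forall x, 0 <= k x) ->
  measurable_fun [set: R] K -> (forall x, 0 <= K x) ->
  measurable_fun [set: R] h -> (forall x, 0 <= h x) ->
  convolution (damped lam k) (K \* damped lam h) t =
  ((expR (- (lam * t)))%:E * convolution k (K \* h)%R t)%E.
Proof.
move=> mk k0 mK K0 mh h0; rewrite /convolution -ge0_integralZl_EFin//.
- apply: eq_integral => s _; rewrite -EFinM; congr EFin.
  have -> : - (lam * t) = - (lam * (t - s)) + - (lam * s) by ring.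
  by rewrite /damped /= expRD; ring.
- by move=> s _; rewrite lee_fin !mulr_ge0.
- apply/measurable_EFinP/measurable_funM; first exact: measurable_fun_shift.
  exact: measurable_funM.
Qed.

(* Young's inequality for [L^p], with a constant made small by the weight
   [exp (- lam t)]. *)
Definition smoothing (p : R) (k K : R -> R) := forall e : R, 0 < e ->
  exists2 lam : R, 0 <= lam & forall h : R -> R,
    measurable_fun [set: R] h -> (forall x, 0 <= h x) ->
    (\int[mu]_t (((expR (- (lam * t)))%:E * convolution k (K \* h)%R t) `^ p) <=
     e%:E * \int[mu]_t (damped lam h t `^ p)%:E)%E.

(** Let m be conjugate to q; then 1/alpha < q is the same as (1 - alpha) m < 1. In
    [convolution_pnorm] the factor raised to p - 1 is bounded by its value for the undamped kernel,
    uniformly in lam, and the remaining integral of the damped kernel is as small as desired. *)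
Lemma smoothing_skernel (p q alpha T : R) (K : R -> R) :
  0 < alpha -> alpha < 1 -> 0 < T -> 1 < p -> alpha^-1 < q ->
  q^-1 <= 1 - p^-1 ->
  measurable_fun [set: R] K -> (forall x, 0 <= K x) ->
  (\int[mu]_s (K s `^ q)%:E < +oo)%E ->
  smoothing p (skernel alpha T) K.
Proof.
move=> al0 al1 T0 p1 alq qp mK K0 iK e e0.
have q0 : 0 < q by apply: lt_trans alq; rewrite invr_gt0.
have qal : q^-1 < alpha by rewrite invf_plt ?posrE.
have qV0 : 0 < q^-1 by rewrite invr_gt0.
pose m := (1 - q^-1)^-1.
have m0 : 0 < m by rewrite invr_gt0 subr_gt0; lra.
have mE : m^-1 = 1 - q^-1 by rewrite invrK.
have m1 : 1 <= m by rewrite /m invf_ge1 ?subr_gt0; lra.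
have am : (1 - alpha) * m < 1.
  by rewrite -ltr_pdivlMr// mul1r mE; lra.
have mk := @measurable_skernel R alpha T.
have k0 := @skernel_ge0 R alpha T.
have [ik smallk] := skernel_pow_small al0 al1 T0 m1 am.
have I0 (f : R -> R) r : (0 <= \int[mu]_x (f x `^ r)%:E)%E.
  by apply: integral_ge0 => x _; rewrite lee_fin powR_ge0.
set M := (((\int[mu]_t (skernel alpha T t `^ m)%:E) + \int[mu]_s (K s `^ q)%:E)
  `^ (p - 1))%E.
have M0 : (0 <= M)%E by exact: poweR_ge0.
have Mfin : M \is a fin_num.
  rewrite ge0_fin_numE; last exact: M0.
  by apply: poweR_lty; exact: lte_add_pinfty ik iK.
(* The added 1 keeps [c] positive, so that the kernel integral can be made at most e / c. *)
pose c := fine M + 1.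
have c0 : 0 < c by rewrite ltr_wpDl// fine_ge0.
have Mc : (M <= c%:E)%E by rewrite -(fineK Mfin) lee_fin lerDl.
have [n smalln] := smallk _ (divr_gt0 e0 c0).
exists n%:R => // h mh h0.
have -> : (\int[mu]_t ((expR (- (n%:R * t)))%:E *
      convolution (skernel alpha T) (K \* h)%R t) `^ p =
    \int[mu]_t convolution (damped n%:R (skernel alpha T))
      (K \* damped n%:R h)%R t `^ p)%E.
  by apply: eq_integral => t _; rewrite -damped_convolution.
have mpow (f : R -> R) r : measurable_fun [set: R] f ->
    measurable_fun [set: R] (fun x => (f x `^ r)%:E).
  by move=> mf; apply/measurable_EFinP;
    apply: (measurableT_comp (measurable_powR _)).
have md lam f : measurable_fun [set: R] f -> measurable_fun [set: R] (damped
  lam f).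
  exact: measurable_damped.
have d0 lam f x : (forall x :
  R, 0 <= f x) -> 0 <= damped lam f x by exact: damped_ge0.
have dk t : damped n%:R (skernel alpha T) t <= skernel alpha T t.
  rewrite /damped /skernel patchE; case: ifPn => [|_]; last by rewrite mulr0.
  rewrite inE/= in_itv/= => /andP[t0 _].
  rewrite ler_piMl//; first by rewrite addr_ge0// invr_ge0 powR_ge0.
  by rewrite -expR0 ler_expR oppr_le0 mulr_ge0.
have := @convolution_pnorm R (damped n%:R (skernel alpha T)) K (damped n%:R h)
  p m q.
move=> /(_ (md _ _ mk) _ mK K0 (md _ _ mh) _ p1 m0 q0).
move=> /(_ (fun x => d0 _ _ x k0) (fun x => d0 _ _ x h0)).
have -> : m^-1 + q^-1 = 1 by rewrite mE subrK.
move=> /(_ erefl qp); rewrite /convolution.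
have -> : (\int[mu]_t
      (\int[mu]_s (damped n%:R (skernel alpha T) (t - s) * K s * damped n%:R h
        s)%:E)
      `^ p = \int[mu]_t (\int[mu]_s
      (damped n%:R (skernel alpha T) (t - s) * (K \* damped n%:R h)%R s)%:E) `^
        p)%E.
  apply: eq_integral => t _; congr (_ `^ _)%E; apply: eq_integral => s _.
  by rewrite /= mulrA.
move=> /le_trans; apply.
rewrite muleA; apply: lee_wpmul2r => //.
apply: (@le_trans _ _ (c%:E * (e / c)%:E)%E); last first.
  by rewrite -EFinM lee_fin mulrC divfK// gt_eqF.
apply: lee_pmul; [exact: poweR_ge0|exact: I0| |exact: smalln].
apply: le_trans Mc; apply: gt0_ler_poweR.
- lra.
- by rewrite in_itv/= leey andbT; apply: adde_ge0; exact: I0.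
- by rewrite in_itv/= leey andbT; apply: adde_ge0; exact: I0.
apply: leeD => //; apply: ge0_le_integral => //.
- by move=> x _; rewrite lee_fin powR_ge0.
- by apply: mpow; exact: md.
- exact: mpow.
by move=> x _; rewrite lee_fin; apply: ge0_ler_powR;
  rewrite ?nnegrE ?d0 ?(ltW m0).
Qed.

(** At p = 1 the exponent of K is infinite and m = 1: the L^1 norm of the convolution is exactly the
    product of the L^1 norms, and K is replaced by its essential bound. *)
Lemma smoothing_skernel1 (alpha T M : R) (K : R -> R) :
  0 < alpha -> alpha < 1 -> 0 < T ->
  measurable_fun [set: R] K -> (forall x, 0 <= K x) ->
  {ae mu, forall x, K x <= M} ->
  smoothing 1 (skernel alpha T) K.
Proof.
move=> al0 al1 T0 mK K0 KM e e0.
have mk := @measurable_skernel R alpha T.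
have k0 := @skernel_ge0 R alpha T.
have am : (1 - alpha) * 1 < 1 by lra.
have [_ smallk] := skernel_pow_small al0 al1 T0 (lexx 1) am.
pose c := `|M| + 1.
have c0 : 0 < c by rewrite ltr_wpDl.
have [n smalln] := smallk _ (divr_gt0 e0 c0).
exists n%:R => // h mh h0.
have mdh := measurable_damped n%:R mh.
have mdk := measurable_damped n%:R mk.
have dh0 x := damped_ge0 n%:R x h0.
have dk0 x := damped_ge0 n%:R x k0.
have -> : (\int[mu]_t ((expR (- (n%:R * t)))%:E *
      convolution (skernel alpha T) (K \* h)%R t) `^ 1 =
    \int[mu]_t convolution (damped n%:R (skernel alpha T)) (K \* damped n%:R
      h)%R t)%E.
  apply: eq_integral => t _; rewrite -damped_convolution// poweRe1//.
  by apply: convolution_ge0 => // x; rewrite mulr_ge0.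
rewrite /convolution integral_convolution//; last 2 first.
- exact: measurable_funM.
- by move=> x; rewrite mulr_ge0.
have -> : (\int[mu]_t (damped n%:R h t `^ 1)%:E = \int[mu]_t (damped n%:R h
  t)%:E)%E.
  by apply: eq_integral => t _; rewrite powRr1.
apply: (@le_trans _ _ ((e / c)%:E * (c%:E * \int[mu]_t (damped n%:R h
  t)%:E))%E); last first.
  by rewrite muleA -EFinM divfK// gt_eqF.
apply: lee_pmul.
- by apply: integral_ge0 => x _; rewrite lee_fin.
- by apply: integral_ge0 => x _; rewrite lee_fin mulr_ge0.
- apply: le_trans smalln; rewrite le_eqVlt; apply/orP; left; apply/eqP.
  by apply: eq_integral => t _; rewrite powRr1.
rewrite -ge0_integralZl_EFin//; first last.
- exact: ltW.
- exact/measurable_EFinP.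
- by move=> x _; rewrite lee_fin.
apply: ae_le_integral => //.
- by move=> x _; rewrite lee_fin mulr_ge0.
- by apply/measurable_EFinP; exact: measurable_funM.
- by move=> x _; rewrite mule_ge0// lee_fin// ltW.
- by apply/measurable_EFinP; exact: measurable_funM.
apply: filterS KM => x KM _; rewrite -EFinM lee_fin ler_wpM2r//.
by rewrite (le_trans KM)// (le_trans (ler_norm _))// lerDl.
Qed.

Lemma poweR_leD (x y : \bar R) (p : R) : (0 <= x)%E -> (0 <= y)%E -> 0 <= p ->
  ((x + y) `^ p <= (2 `^ p)%:E * (x `^ p + y `^ p))%E.
Proof.
move=> x0 y0 p0.
wlog xy : x y x0 y0 / (x <= y)%E.
  move=> H; have [/H|/ltW/H] := leP x y; first exact.
  by rewrite addeC (addeC (y `^ p)%E); exact.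
apply: (@le_trans _ _ ((2%:E * y) `^ p)%E).
  apply: gt0_ler_poweR => //;
    rewrite ?in_itv/= ?leey ?andbT ?adde_ge0 ?mule_ge0//.
  by rewrite (_ : 2%:E = 1%:E + 1%:E)%E ?EFinD// ge0_muleDl// mul1e leeD.
rewrite poweRM// poweR_EFin lee_wpmul2l ?lee_fin ?powR_ge0//.
by rewrite leeDr// poweR_ge0.
Qed.

(** Under the weight exp(-lam p t) the convolution term costs at most half of the left-hand side,
    and the finiteness assumed of z allows this half to be subtracted. The constant is chosen before
    z and e, which is what makes the bounds on the Picard partial sums uniform. *)
Lemma gronwall_Lp (p T c : R) (k K : R -> R) : 1 <= p -> 0 < T -> 0 <= c ->
  measurable_fun [set: R] k -> (forall x, 0 <= k x) ->
  measurable_fun [set: R] K -> (forall x, 0 <= K x) ->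
  smoothing p k K ->
  exists2 C : R, 0 <= C & forall (z : R -> R) (e : R -> \bar R),
    measurable_fun [set: R] z -> (forall x, 0 <= z x) ->
    (forall t, t \notin `[0, T] -> z t = 0) ->
    measurable_fun `[0, T] e -> (forall t, (0 <= e t)%E) ->
    (\int[mu]_t (z t `^ p)%:E < +oo)%E ->
    {ae mu, forall t, t \in `[0, T] ->
      ((z t)%:E <= e t + c%:E * convolution k (K \* z)%R t)%E} ->
    (\int[mu]_t (z t `^ p)%:E <= C%:E * \int[mu]_(t in `[0%R, T]) (e t `^ p))%E.
Proof.
move=> p1 T0 c0 mk k0 mK K0 smK.
have p0 : 0 < p by lra.
(* [b] is the coefficient of the convolution term after splitting the p-th power of the sum. The
   value of [eps] below gives b eps <= 1/2, with b + 1 in the denominator in case b = 0. *)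
pose b := 2 `^ p * c `^ p.
have b0 : 0 <= b by rewrite mulr_ge0 ?powR_ge0.
pose eps := ((b + 1) * 2)^-1.
have eps0 : 0 < eps by rewrite invr_gt0 mulr_gt0// ltr_wpDl.
have beps : b * eps <= 2^-1.
  by rewrite /eps invfM mulrA ler_piMl// ler_pdivrMr ?ltr_wpDl// mul1r lerDl.
have [lam lam0 Hlam] := smK _ eps0.
(* The factor 2 comes from absorbing one half, 2^p from splitting the sum, and the exponential from
   removing the weight on [0, T]. *)
exists (expR (lam * T * p) * (2 * 2 `^ p)).
  by rewrite !mulr_ge0 ?expR_ge0 ?powR_ge0.
move=> z e mz z0 zout me e0 zfin ineq.
have mdz := measurable_damped lam mz.
have dz0 x := damped_ge0 lam x z0.
have mpow (f : R -> R) r : measurable_fun [set: R] f ->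
    measurable_fun [set: R] (fun x => (f x `^ r)%:E).
  by move=> mf; apply/measurable_EFinP;
    apply: (measurableT_comp (measurable_powR _)).
have toitv (f : R -> R) : (forall t, t \notin `[0, T] -> f t = 0) ->
    (\int[mu]_t (f t `^ p)%:E = \int[mu]_(t in `[0%R, T]) (f t `^ p)%:E)%E.
  move=> fout; rewrite [RHS]integral_mkcond; apply: eq_integral => t _.
  rewrite patchE; case: ifPn => // tT.
  rewrite fout ?powR0 ?gt_eqF//.
  by apply: contra tT => tT; rewrite inE.
have dzout t : t \notin `[0, T] -> damped lam z t = 0.
  by move=> tT; rewrite /damped zout// mulr0.
set a := (\int[mu]_t (damped lam z t `^ p)%:E)%E.
set E := (\int[mu]_(t in `[0%R, T]) (e t `^ p))%E.
have E0 : (0 <= E)%E by apply: integral_ge0 => x _; exact: poweR_ge0.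
have a0 : (0 <= a)%E by apply: integral_ge0 => x _; rewrite lee_fin powR_ge0.
have ez : (\int[mu]_t (z t `^ p)%:E <= (expR (lam * T * p))%:E * a)%E.
  rewrite /a -ge0_integralZl_EFin ?expR_ge0//; first last.
  - exact: mpow.
  - by move=> x _; rewrite lee_fin powR_ge0.
  apply: ge0_le_integral => //.
  - by move=> x _; rewrite lee_fin powR_ge0.
  - exact: mpow.
  - by apply: emeasurable_funM => //; exact: mpow.
  move=> t _; rewrite -EFinM lee_fin.
  have [tT|tT] := boolP (t \in `[0, T]); last first.
    by rewrite zout// powR0 ?gt_eqF// mulr_ge0 ?powR_ge0 ?expR_ge0.
  rewrite /damped powRM ?expR_ge0// mulrA ler_peMl ?powR_ge0//.
  rewrite -expRM -expRD -expR0 ler_expR.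
  have -> : lam * T * p + - (lam * t) * p = lam * (T - t) * p by ring.
  move: tT; rewrite in_itv/= => /andP[_ tT].
  by rewrite !mulr_ge0 ?subr_ge0// ltW.
have afin : (a < +oo)%E.
  apply: le_lt_trans zfin; apply: ge0_le_integral => //.
  - by move=> x _; rewrite lee_fin powR_ge0.
  - exact: mpow.
  - exact: mpow.
  move=> t _; rewrite lee_fin; apply: ge0_ler_powR; rewrite ?nnegrE ?(ltW p0)//.
  have [tT|tT] := boolP (t \in `[0, T]); last by rewrite dzout.
  rewrite /damped ler_piMl// -expR0 ler_expR oppr_le0 mulr_ge0//.
  by move: tT; rewrite in_itv/= => /andP[].
pose V t := ((expR (- (lam * t)))%:E * convolution k (K \* z)%R t)%E.
have V0 t : (0 <= V t)%E.
  rewrite mule_ge0 ?lee_fin ?expR_ge0// convolution_ge0// => x.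
  by rewrite mulr_ge0.
have mV : measurable_fun [set: R] V.
  apply: emeasurable_funM.
    apply/measurable_EFinP; apply: measurableT_comp => //.
    by apply: measurableT_comp => //; exact: measurable_funM.
  apply: measurable_convolution => //; first exact: measurable_funM.
  by move=> x; rewrite mulr_ge0.
have mVp : measurable_fun [set: R] (fun t => V t `^ p)%E.
  by apply: (measurableT_comp (measurable_poweR _)).
have mep : measurable_fun `[0, T] (fun t => e t `^ p)%E.
  by apply: (measurableT_comp (measurable_poweR _)).
have step : (a <= (2 `^ p)%:E * E + (2^-1)%:E * a)%E.
  rewrite {1}/a toitv//.
  apply: (@le_trans _ _ (\int[mu]_(t in `[0%R, T])
     ((2 `^ p)%:E * (e t `^ p) + b%:E * (V t `^ p)))%E).
    apply: ae_le_integral => //.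
    - by move=> x _; rewrite lee_fin powR_ge0.
    - by apply: measurable_funTS; exact: mpow.
    - move=> t _; apply: adde_ge0; apply: mule_ge0;
      rewrite ?poweR_ge0 ?lee_fin ?powR_ge0//.
    - apply: emeasurable_funD; apply: emeasurable_funM => //.
      exact: measurable_funTS.
    apply: filterS ineq => t ineq tT.
    have {}ineq := ineq tT.
    have tT' : 0 <= t <= T by move: tT; rewrite /= in_itv.
    apply: (@le_trans _ _ ((e t + c%:E * V t) `^ p)%E).
      rewrite -poweR_EFin; apply: gt0_ler_poweR;
        rewrite ?in_itv/= ?leey ?andbT ?lee_fin//.
      - exact: ltW.
      - by apply: adde_ge0 => //; apply: mule_ge0.
      rewrite /damped EFinM.
      apply: (@le_trans _ _ ((expR (- (lam * t)))%:E *
          (e t + c%:E * convolution k (K \* z)%R t))%E).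
        by apply: lee_wpmul2l => //; rewrite lee_fin expR_ge0.
      have cv0 : (0 <= c%:E * convolution k (K \* z)%R t)%E.
        apply: mule_ge0 => //; apply: convolution_ge0 => // x.
        by rewrite mulr_ge0.
      rewrite ge0_muleDr//; apply: leeD; last by rewrite /V muleCA.
      rewrite -[leRHS]mul1e; apply: lee_wpmul2r => //.
      rewrite lee_fin -expR0 ler_expR oppr_le0 mulr_ge0//.
      by case/andP: tT'.
    apply: (le_trans (poweR_leD _ _ (ltW p0))) => //; first exact: mule_ge0.
    rewrite ge0_muleDr ?poweR_ge0//; apply: leeD => //.
    by rewrite poweRM// poweR_EFin muleA -EFinM.
  have m1 : measurable_fun `[0, T] (fun t => (2 `^ p)%:E * e t `^ p)%E.
    by apply: emeasurable_funM.
  have m2 : measurable_fun `[0, T] (fun t => b%:E * V t `^ p)%E.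
    by apply: emeasurable_funM => //; exact: measurable_funTS.
  rewrite ge0_integralD//; first last.
  - by move=> t _; rewrite mule_ge0 ?poweR_ge0.
  - by move=> t _; rewrite mule_ge0 ?poweR_ge0 ?lee_fin ?powR_ge0.
  rewrite ge0_integralZl_EFin ?powR_ge0//; last by move=> t _; exact: poweR_ge0.
  apply: leeD => //.
  rewrite ge0_integralZl_EFin//; first last.
  - exact: measurable_funTS.
  - by move=> t _; exact: poweR_ge0.
  apply: (@le_trans _ _ (b%:E * (eps%:E * a))%E).
    apply: lee_wpmul2l => //; apply: le_trans (Hlam z mz z0).
    apply: ge0_subset_integral => //.
    by move=> t _; exact: poweR_ge0.
  by rewrite muleA -EFinM lee_wpmul2r// lee_fin.
apply: (le_trans ez).
rewrite EFinM -muleA; apply: lee_wpmul2l; first by rewrite lee_fin expR_ge0.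
have afn : a \is a fin_num by rewrite ge0_fin_numE.
move: step; rewrite -(fineK afn); set a' := fine a.
(* If E is finite the claim is linear arithmetic in real numbers; if E is infinite the right-hand
   side is infinite, its coefficient being positive. *)
have [Efn|] := boolP (E \is a fin_num).
  rewrite -(fineK Efn) -!EFinM -EFinD !lee_fin; set E' := fine E; lra.
rewrite ge0_fin_numE// -leNgt leye_eq => /eqP -> _.
by rewrite gt0_muley ?leey// lte_fin mulr_gt0// powR_gt0.
Qed.

End gronwall.

(** * Membership in L^p of [0, T] through integrals of powers *)

Section Lp_interval.
Context {R : realType}.
Local Notation mu := (@lebesgue_measure R).

Lemma integral_Lp_restrict (T r : R) (h : R -> R) : 0 < r ->
  (\int[mu]_t (`|(h \_ `[0, T]) t| `^ r)%:E =
   \int[mu]_(t in `[0%R, T]) (`|h t| `^ r)%:E)%E.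
Proof.
move=> r0; rewrite [RHS]integral_mkcond; apply: eq_integral => t _.
rewrite !patchE; case: ifPn => // _.
by rewrite normr0 powR0// gt_eqF.
Qed.

Lemma integral_powR_restrict (T r : R) (h : R -> R) : 0 < r ->
  (forall s, s \in `[0, T] -> 0 <= h s) ->
  (\int[mu]_t ((h \_ `[0, T]) t `^ r)%:E =
   \int[mu]_(t in `[0%R, T]) (`|h t| `^ r)%:E)%E.
Proof.
move=> r0 h0; rewrite -(integral_Lp_restrict _ _ r0).
apply: eq_integral => t _; rewrite ger0_norm//.
by apply: restrict_ge0 => s /= sT; exact: h0.
Qed.

Lemma Lp_normE (T r : R) (h : R -> R) : 0 < r ->
  Lp_norm T r%:E h = ((\int[mu]_(t in `[0%R, T]) (`|h t| `^ r)%:E) `^ r^-1)%E.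
Proof.
by move=> r0; rewrite /Lp_norm unlock /Lnorm -integral_Lp_restrict.
Qed.

Lemma in_LpP (T r : R) (h : R -> R) : 0 < r ->
  in_Lp T r%:E h <-> measurable_fun [set: R] (h \_ `[0, T]) /\
    (\int[mu]_(t in `[0%R, T]) (`|h t| `^ r)%:E < +oo)%E.
Proof.
move=> r0; have rV0 : r^-1 != 0 by rewrite invr_neq0// gt_eqF.
rewrite /in_Lp; split.
  rewrite inE => /andP[]; rewrite !inE /= => mh.
  rewrite /finite_norm -[X in (X < _)%E]/(Lp_norm T r%:E h) Lp_normE// => fin.
  by split=> //; exact: lty_poweRy fin.
move=> [mh fin]; rewrite inE; apply/andP; rewrite !inE /=; split => //.
rewrite /finite_norm -[X in (X < _)%E]/(Lp_norm T r%:E h) Lp_normE//.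
exact: poweR_lty.
Qed.

Lemma measurable_in_Lplus (T : R) (q : \bar R) (h : R -> R) :
  in_Lplus T q h -> measurable_fun [set: R] (h \_ `[0, T]).
Proof.
have mLp r : in_Lp T r h -> measurable_fun [set: R] (h \_ `[0, T]).
  by rewrite /in_Lp inE => /andP[]; rewrite !inE.
by case: q => [r [r' _]| |]; exact: mLp.
Qed.

Lemma in_LyP (T : R) (h : R -> R) : in_Lp T +oo%E h ->
  measurable_fun [set: R] (h \_ `[0, T]) /\
  exists M, {ae mu, forall t, (h \_ `[0, T]) t <= M}.
Proof.
rewrite /in_Lp inE => /andP[]; rewrite !inE /= => mh.
rewrite /finite_norm unlock /Lnorm.
(* The norm with exponent infinity is defined by cases on whether the whole space has positive
   measure. *)
have -> : (0%E < mu [set: R])%E by rewrite -set_itvNyy lebesgue_measure_itv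
  ltry.
set g := h \_ `[0, T].
move=> /(@ess_supr_bounded _ _ _ mu (Num.norm \o g)) [M HM].
split => //; exists M.
by apply: filterS HM => t; apply: le_trans; exact: ler_norm.
Qed.

Lemma le_powR_interp (a p r : R) : 0 <= a -> 0 <= p -> p <= r ->
  a `^ p <= 1 + a `^ r.
Proof.
move=> a0 p0 pr; have [a1|/ltW a1] := leP a 1.
  rewrite (@le_trans _ _ 1)//; last by rewrite lerDl powR_ge0.
  by have := @ge0_ler_powR R p p0 a 1; rewrite powR1 !nnegrE; apply.
by rewrite (@le_trans _ _ (a `^ r))//; [exact: ler_powR|rewrite lerDr].
Qed.

(** The interval has finite measure and a^p <= 1 + a^r. *)
Lemma integral_Lp_mono (T p r : R) (h : R -> R) : 0 <= p -> p <= r ->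
  measurable_fun `[0, T] h ->
  (\int[mu]_(t in `[0%R, T]) (`|h t| `^ r)%:E < +oo)%E ->
  (\int[mu]_(t in `[0%R, T]) (`|h t| `^ p)%:E < +oo)%E.
Proof.
move=> p0 pr mh fin.
have mp s : measurable_fun `[0, T] (fun t => (`|h t| `^ s)%:E).
  apply/measurable_EFinP; apply: (measurableT_comp (measurable_powR _)).
  exact: measurableT_comp.
apply: (@le_lt_trans _ _ (\int[mu]_(t in `[0%R,
  T]) (1%:E + (`|h t| `^ r)%:E))%E).
  apply: ge0_le_integral => //; first exact: mp.
    by apply: emeasurable_funD => //; exact: mp.
  by move=> t _; rewrite -EFinD lee_fin le_powR_interp.
rewrite ge0_integralD//; last exact: mp.
rewrite lte_add_pinfty// integral_cst// mul1e/= lebesgue_measure_itv/=.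
by case: ifP => _; rewrite -?EFinB ltry.
Qed.

End Lp_interval.

(** * Smoothing for the coefficients K and K0 *)

Section smoothing_data.
Context {R : realType}.
Local Notation mu := (@lebesgue_measure R).

(** The case e = 1 of [smoothing], freed of its weight, which on [0, T] lies between exp(-lam T) and
    1. *)
Lemma smoothing_bounded (p T : R) (k K : R -> R) : 0 < p ->
  measurable_fun [set: R] k -> (forall x, 0 <= k x) ->
  measurable_fun [set: R] K -> (forall x, 0 <= K x) ->
  smoothing p k K ->
  exists2 C : R, 0 <= C & forall h : R -> R,
    measurable_fun [set: R] h -> (forall x, 0 <= h x) ->
    (forall t, t \notin `[0, T] -> h t = 0) ->
    (\int[mu]_(t in `[0%R, T]) (convolution k (K \* h)%R t `^ p) <=
     C%:E * \int[mu]_(t in `[0%R, T]) (h t `^ p)%:E)%E.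
Proof.
move=> p0 mk k0 mK K0 smK.
have [lam lam0 Hlam] := smK _ ltr01.
exists (expR (lam * T * p)); first exact: expR_ge0.
move=> h mh h0 hout.
have {Hlam} := Hlam h mh h0; rewrite mul1e => Hlam.
pose V t := convolution k (K \* h)%R t.
have V0 t : (0 <= V t)%E by apply: convolution_ge0 => // x; rewrite mulr_ge0.
have mV : measurable_fun [set: R] V.
  apply: measurable_convolution => //; first exact: measurable_funM.
  by move=> x; rewrite mulr_ge0.
have mexp : measurable_fun [set: R] (fun t => (expR (- (lam * t)))%:E).
  apply/measurable_EFinP; apply: measurableT_comp => //.
  by apply: measurableT_comp => //; exact: measurable_funM.
have mW : measurable_fun [set: R] (fun t => (expR (- (lam * t)))%:E * V t)%E.
  exact: emeasurable_funM.
have mWp : measurable_fun [set: R] (fun t =>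
  ((expR (- (lam * t)))%:E * V t) `^ p)%E.
  by apply: (measurableT_comp (measurable_poweR _)).
have dle : (\int[mu]_t (damped lam h t `^ p)%:E <=
    \int[mu]_(t in `[0%R, T]) (h t `^ p)%:E)%E.
  rewrite [leRHS]integral_mkcond.
  have mhp : measurable_fun `[0, T] (fun t : R => (h t `^ p)%:E).
    apply/measurable_EFinP; apply: (measurableT_comp (measurable_powR _)).
    exact: measurable_funTS.
  apply: ge0_le_integral => //.
  - by move=> t _; rewrite lee_fin powR_ge0.
  - apply/measurable_EFinP; apply: (measurableT_comp (measurable_powR _)).
    exact: measurable_damped.
  - exact/(measurable_restrictT _ _).1.
  move=> t _; rewrite patchE; case: ifPn => tT.
    rewrite lee_fin ge0_ler_powR ?nnegrE ?damped_ge0 ?(ltW p0)//.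
    move: tT; rewrite inE /= in_itv /= => /andP[t0 _].
    by rewrite /damped ler_piMl// -expR0 ler_expR oppr_le0 mulr_ge0.
  rewrite /damped hout ?mulr0 ?powR0 ?gt_eqF//.
  by apply: contra tT => tT; rewrite inE.
apply: (@le_trans _ _ ((expR (lam * T * p))%:E *
   \int[mu]_t ((expR (- (lam * t)))%:E * V t) `^ p)%E); last first.
  apply: lee_wpmul2l; first by rewrite lee_fin expR_ge0.
  exact: le_trans Hlam dle.
rewrite -ge0_integralZl_EFin ?expR_ge0//; last by move=> t _; exact: poweR_ge0.
rewrite [leLHS]integral_mkcond; apply: ge0_le_integral => //.
- by move=> x _; apply: erestrict_ge0 => t _; exact: poweR_ge0.
- apply/(measurable_restrictT _ _).1 => //.
  by apply: measurable_funTS; apply: (measurableT_comp (measurable_poweR _)).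
- exact: emeasurable_funM.
move=> t _; rewrite patchE; case: ifPn => tT; last first.
  by rewrite mule_ge0 ?lee_fin ?expR_ge0 ?poweR_ge0.
rewrite poweRM ?lee_fin ?expR_ge0// muleA poweR_EFin -EFinM -expRM -expRD.
rewrite -[leLHS]mul1e lee_wpmul2r ?poweR_ge0// lee_fin -expR0 ler_expR.
have -> : lam * T * p + - (lam * t) * p = lam * (T - t) * p by ring.
move: tT; rewrite inE /= in_itv/= => /andP[_ tT].
by rewrite !mulr_ge0 ?subr_ge0// ltW.
Qed.

Lemma smoothing_fin (p T : R) (k K h : R -> R) : 0 < p ->
  measurable_fun [set: R] k -> (forall x, 0 <= k x) ->
  measurable_fun [set: R] K -> (forall x, 0 <= K x) ->
  smoothing p k K ->
  measurable_fun [set: R] h -> (forall x, 0 <= h x) ->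
  (forall t, t \notin `[0, T] -> h t = 0) ->
  (\int[mu]_(t in `[0%R, T]) (h t `^ p)%:E < +oo)%E ->
  (\int[mu]_(t in `[0%R, T]) (convolution k (K \* h)%R t `^ p) < +oo)%E.
Proof.
move=> p0 mk k0 mK K0 smK mh h0 hout fin.
have [C C0 HC] := smoothing_bounded T p0 mk k0 mK K0 smK.
apply: (le_lt_trans (HC h mh h0 hout)).
by apply: lte_mul_pinfty; rewrite ?lee_fin.
Qed.

Context {T p alpha : R}.
Hypotheses (T0 : 0 < T) (p1 : 1 <= p) (al0 : 0 < alpha) (al1 : alpha < 1).

(** The hypothesis on K splits by p. At p = 1 the conjugate exponent is infinite and K is
    essentially bounded; otherwise K lies in some L^q with q above both 1/alpha and p/(p - 1), and
    the latter gives 1/q < 1 - 1/p. *)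
Lemma smoothing_coefficient (K : R -> R) :
  (forall s, s \in `[0, T] -> 0 <= K s) ->
  in_Lplus T (maxe (alpha^-1)%:E (hoelder_conjugate p%:E)) K ->
  smoothing p (skernel alpha T) (K \_ `[0, T]).
Proof.
move=> K0 LK.
have Kr0 : forall s, 0 <= (K \_ `[0, T]) s by apply: restrict_ge0 => s /= sT;
  exact: K0.
have [pE|pN1] := eqVneq p 1.
  have cE : (hoelder_conjugate p%:E = +oo)%E by rewrite pE hoelder_conjugate1.
  move: LK; rewrite cE maxey /= => /in_LyP[mK [M KM]].
  by rewrite pE; apply: smoothing_skernel1 KM.
have p1' : 1 < p by rewrite lt_neqAle eq_sym pN1.
have cE : hoelder_conjugate p%:E = (p / (p - 1))%:E.
  rewrite /hoelder_conjugate /= eqe gt_eqF; last by lra.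
  by rewrite -EFinB inver subr_eq0 (negbTE pN1).
move: LK; rewrite cE -EFin_max /= => -[q]; rewrite gt_max => /andP[alq pq].
have q0 : 0 < q by apply: lt_trans alq; rewrite invr_gt0.
move=> /(in_LpP _ _ q0)[mK fin].
apply: (smoothing_skernel al0 al1 T0 p1' alq _ mK Kr0).
  have pp0 : 0 < p / (p - 1) by rewrite divr_gt0; lra.
  have : q^-1 < (p / (p - 1))^-1 by rewrite ltf_pV2 ?posrE.
  have -> : (p / (p - 1))^-1 = 1 - p^-1 by field; lra.
  exact: ltW.
by rewrite (integral_powR_restrict q0 K0).
Qed.

(** The constant 1 belongs to every L^q of a bounded interval. This serves when K0 lies in L^p
    itself: K0 is then the input and 1 the coefficient. *)
Lemma smoothing_indic : smoothing p (skernel alpha T) ((fun _ : R =>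
  1 : R) \_ `[0, T]).
Proof.
apply: smoothing_coefficient => //.
have fin r : 0 < r -> in_Lp T r%:E (fun _ : R => 1 : R).
  move=> r0; apply/in_LpP => //; split.
    exact/(measurable_restrictT _ _).1.
  under eq_integral do rewrite normr1 powR1.
  rewrite integral_cst// mul1e/= lebesgue_measure_itv/=.
  by case: ifP => _; rewrite -?EFinB ltry.
rewrite /in_Lplus; case E : (maxe _ _) => [r| |].
- exists (Num.max r 0 + 1); first by rewrite ltr_pwDr// le_max lexx.
  by apply: fin; rewrite ltr_wpDl// le_max lexx orbT.
- rewrite /in_Lp inE; apply/andP; rewrite !inE /=; split.
    exact/(measurable_restrictT _ _).1.
  rewrite /finite_norm unlock /Lnorm; case: ifP => // _.
  apply: (@le_lt_trans _ _ 1%E); last by rewrite ltry.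
  apply/ess_supP; apply: nearW => t /=; rewrite patchE.
  by case: ifP => _; rewrite lee_fin ?normr1 ?normr0.
- have : ((alpha^-1)%:E <= maxe (alpha^-1)%:E (hoelder_conjugate p%:E))%E.
    by rewrite le_max lexx.
  by rewrite E leeNy_eq.
Qed.

(* [K0 = K0^(1 - r/p) K0^(r/p)] with [K0^(r/p)] in [L^p] reduces this to the
   case of a coefficient. *)
Lemma convolution_source_fin (K0 : R -> R) :
  (forall s, s \in `[0, T] -> 0 <= K0 s) ->
  in_Lplus T (maxe (p / (1 + alpha * p))%:E 1%:E) K0 ->
  (\int[mu]_(t in `[0%R, T])
     (convolution (skernel alpha T) (K0 \_ `[0, T])%R t `^ p) < +oo)%E.
Proof.
move=> K00; rewrite -EFin_max /= => -[r]; rewrite gt_max => /andP[pr r1].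
have p0 : 0 < p := lt_le_trans ltr01 p1.
have r0 : 0 < r by lra.
move=> /(in_LpP _ _ r0)[mK0 fin].
pose w := K0 \_ `[0, T].
have w0 : forall s, 0 <= w s by apply: restrict_ge0 => s /= sT; exact: K00.
have wout t : t \notin `[0, T] -> w t = 0.
  move=> tT; rewrite /w patchE ifF//; apply/negP; rewrite inE/=.
  exact/negP.
have mk := @measurable_skernel R alpha T.
have k0 := @skernel_ge0 R alpha T.
(* If p <= r then K0 is already in L^p. The factorization is used when r < p, where 1 - r/p is
   positive. *)
have [rp|pr'] := ltP r p; last first.
  pose I := (fun _ : R => 1 : R) \_ `[0, T].
  have mI : measurable_fun [set: R] I by exact/(measurable_restrictT _ _).1.
  have -> : (K0 \_ `[0, T]) = (I \* w)%R.
    by apply/funext => t; rewrite /I /w /= !patchE; case: ifP;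
      rewrite ?mul1r ?mul0r.
  have I0 s : 0 <= I s by apply: restrict_ge0.
  apply: (smoothing_fin p0 mk k0 mI I0 smoothing_indic mK0 w0 wout).
  have := integral_Lp_mono (ltW p0) pr' ((measurable_restrictT _
    (measurable_itv _)).2 mK0) fin.
  have -> // : (\int[mu]_(t in `[0%R, T]) (`|K0 t| `^ p)%:E =
             \int[mu]_(t in `[0%R, T]) (w t `^ p)%:E)%E.
  apply: eq_integral => t; rewrite inE /= => tT.
  by rewrite /w patchE mem_set// ger0_norm// K00.
have p1' : 1 < p by lra.
pose K1 (s : R) := w s `^ (1 - r / p).
pose h (s : R) := w s `^ (r / p).
have rp0 : r / p != 0 by rewrite gt_eqF// divr_gt0.
have rp1 : 0 < 1 - r / p by rewrite subr_gt0 ltr_pdivrMr// mul1r.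
have mpow s : measurable_fun [set: R] (fun x => w x `^ s).
  by apply: (measurableT_comp (measurable_powR _)).
have -> : (K0 \_ `[0, T]) = (K1 \* h)%R.
  apply/funext => t; rewrite /K1 /h /= -powRD; last by rewrite subrK oner_eq0.
  by rewrite subrK powRr1.
have wfin : (\int[mu]_s (w s `^ r)%:E < +oo)%E.
  by rewrite (integral_powR_restrict r0 K00).
have K10 s : 0 <= K1 s by exact: powR_ge0.
have h0 s : 0 <= h s by exact: powR_ge0.
have hout t : t \notin `[0, T] -> h t = 0 by move=> tT; rewrite /h wout// powR0.
apply: (smoothing_fin p0 mk k0 (mpow _) K10 _ (mpow _) h0 hout).
(* Chosen so that K1^q = K0^r, which is integrable. Then 1/q = 1/r - 1/p, so that r > p / (1 + alpha
   p) becomes 1/q < alpha, and r > 1 gives 1/q <= 1 - 1/p. *)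
- pose q := r / (1 - r / p).
  have q0 : 0 < q by rewrite divr_gt0.
  have qE : q^-1 = r^-1 - p^-1 by rewrite /q; field; rewrite !gt_eqF//=; lra.
  have ral : r^-1 < p^-1 + alpha.
    have d0 : 0 < p / (1 + alpha * p) by rewrite divr_gt0// ltr_wpDr//
      mulr_ge0// ltW.
    have : r^-1 < (p / (1 + alpha * p))^-1 by rewrite ltf_pV2 ?posrE.
    have -> // : (p / (1 + alpha * p))^-1 = p^-1 + alpha.
    have : 0 < 1 + alpha * p by rewrite ltr_wpDr// mulr_ge0// ltW.
    by move=> ?; field; lra.
  have rV1 : r^-1 < 1 by rewrite invf_lt1.
  have alq : alpha^-1 < q by rewrite invf_plt ?posrE// qE; lra.
  have qp : q^-1 <= 1 - p^-1 by rewrite qE; lra.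
  apply: (smoothing_skernel al0 al1 T0 p1' alq qp (mpow _) K10).
  rewrite [ltLHS](_ : _ = (\int[mu]_s (w s `^ r)%:E)%E); first exact: wfin.
  apply: eq_integral => t _; rewrite /K1 -powRrM; congr ((_ `^ _)%:E).
  by rewrite /q mulrC divfK// gt_eqF.
apply: le_lt_trans wfin.
rewrite [leRHS](_ : _ = (\int[mu]_s (h s `^ p)%:E)%E); last first.
  by apply: eq_integral => t _; rewrite /h -powRrM divfK ?gt_eqF.
apply: ge0_subset_integral; [exact: measurable_itv|exact: measurableT| | |].
- by apply/measurable_EFinP; apply: (measurableT_comp (measurable_powR _));
  exact: mpow.
- by move=> t _; rewrite lee_fin powR_ge0.
- by [].
Qed.

(* At [s = t] the integrand takes the junk value 1, as [skernel alpha T 0]. *)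
Lemma convolution_skernelE (w : R -> R) t : t \in `[0, T] ->
  convolution (skernel alpha T) (w \_ `[0, T]) t =
  (\int[mu]_(s in `[0%R, t]) ((((t - s) `^ (1 - alpha))^-1 + 1) * w s)%:E)%E.
Proof.
rewrite in_itv/= => /andP[t0 tT]; rewrite [RHS]integral_mkcond.
apply: eq_integral => s _; rewrite [RHS]patchE /skernel !patchE.
have [st|st] := boolP (s \in `[0, t]%classic).
  have := set_mem st; rewrite /= in_itv /= => /andP[s0 st'].
  rewrite !mem_set//= in_itv/=; first by rewrite s0 (le_trans st').
  by rewrite subr_ge0 st' lerBlDr (le_trans tT)// lerDl.
have [sT|sT] := boolP (s \in `[0, T]%classic); last by rewrite mulr0.
rewrite ifF ?mul0r//; apply/negP; rewrite inE /= in_itv/= => /andP[ts _].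
move/negP : st; apply; rewrite inE /= in_itv /=.
have := set_mem sT; rewrite /= in_itv /= => /andP[-> _].
by rewrite -subr_ge0.
Qed.

End smoothing_data.

(** * The Euclidean norm, up to constants *)

Section euclidean.
Context {R : realType} {n : nat}.
Implicit Types x y : 'rV[R]_n.

Lemma enorm_ge0 x : 0 <= enorm x.
Proof. exact: sqrtr_ge0. Qed.

Lemma ler_coord_enorm x i : `|x ord0 i| <= enorm x.
Proof.
rewrite /enorm -sqrtr_sqr ler_wsqrtr// (bigD1 i)//= lerDl.
by apply: sumr_ge0 => j _; rewrite sqr_ge0.
Qed.

(** The sharp constant is the square root of n; [n.+1] is larger and at least 1 even for n = 0, so
    that its powers can be increased freely. *)
Lemma enorm_le_coord x (B : R) : 0 <= B -> (forall i, `|x ord0 i| <= B) ->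
  enorm x <= n.+1%:R * B.
Proof.
move=> B0 xB.
have nB0 : 0 <= n.+1%:R * B by rewrite mulr_ge0.
rewrite /enorm -[leRHS]ger0_norm// -sqrtr_sqr ler_wsqrtr//.
apply: (@le_trans _ _ (\sum_(i < n) B ^+ 2)).
  apply: ler_sum => i _; rewrite -[x ord0 i ^+ 2]ger0_norm ?sqr_ge0//.
  by rewrite normrX ler_sqr ?nnegrE.
rewrite sumr_const card_ord -[_ *+ n]mulr_natl exprMn; apply: ler_wpM2r.
  exact: sqr_ge0.
rewrite -natrX ler_nat (leq_trans (leqnSn n))//.
by rewrite expnS expn1; exact: leq_pmulr.
Qed.

Lemma enorm0 : enorm (0 : 'rV[R]_n) = 0.
Proof. by rewrite /enorm big1 ?sqrtr0// => i _; rewrite mxE expr0n. Qed.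

Lemma enormN x : enorm (- x) = enorm x.
Proof.
by congr Num.sqrt; apply: eq_bigr => i _; rewrite mxE sqrrN.
Qed.

Lemma enormZ a x : enorm (a *: x) = `|a| * enorm x.
Proof.
rewrite /enorm -sqrtr_sqr -sqrtrM ?sqr_ge0// mulr_sumr; congr Num.sqrt.
by apply: eq_bigr => i _; rewrite mxE exprMn.
Qed.

(* The triangle inequality up to a constant, which is all that is needed. *)
Lemma enormD_le x y : enorm (x + y) <= n.+1%:R * (enorm x + enorm y).
Proof.
apply: enorm_le_coord => [|i]; first by rewrite addr_ge0 ?enorm_ge0.
rewrite mxE (le_trans (ler_normD _ _))//.
by rewrite lerD// ler_coord_enorm.
Qed.

Lemma enormB_le x y : enorm (x - y) <= n.+1%:R * (enorm x + enorm y).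
Proof. by rewrite -(enormN y); exact: enormD_le. Qed.

Lemma enorm_eq0 x : enorm x = 0 -> x = 0.
Proof.
move=> x0; apply/rowP => i; rewrite mxE; apply/normr0_eq0/eqP.
by rewrite -normr_le0 normr_id -x0 ler_coord_enorm.
Qed.

End euclidean.

(** * Measurability of vector-valued maps *)

Section measurable_rV.
Context {R : realType} {n : nat}.

Lemma measurable_coord (i : 'I_n) :
  measurable_fun [set: 'rV[R]_n] (fun x => x ord0 i).
Proof.
move=> _ Y mY; rewrite setTI; apply: sub_sigma_algebra => /=.
rewrite -bigcup_seq/=; exists i => /=; first by rewrite mem_index_enum.
by exists Y => //; rewrite setTI.
Qed.

(** The coordinates generate the sigma-algebra of row vectors, so it suffices to take preimages of
    sets that constrain a single coordinate. *)
Lemma measurable_fun_rVP d (X : measurableType d) (D : set X)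
    (f : X -> 'rV[R]_n) : measurable D ->
  (measurable_fun D f <-> forall i, measurable_fun D (fun x => f x ord0 i)).
Proof.
move=> mD; split=> [mf i|mf].
  by apply: (measurableT_comp (measurable_coord i)).
apply: (@measurability _ _ _ _ D f
  (\big[setU/set0]_(i < n) preimage_set_system setT
     (fun x : 'rV[R]_n => x ord0 i) measurable)) => //.
move=> _ [A + <-]; rewrite -bigcup_seq/= => -[i _ [Y mY <-]].
by rewrite setTI; exact: mf.
Qed.

Lemma measurable_enorm : measurable_fun [set: 'rV[R]_n] (@enorm R n).
Proof.
rewrite (_ : @enorm R n = fun x => (\sum_i x ord0 i ^+ 2) `^ 2^-1); last first.
  apply/funext => x; rewrite powR12_sqrt//.
  by apply: sumr_ge0 => i _; rewrite sqr_ge0.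
apply: (measurableT_comp (measurable_powR _)).
apply: measurable_sum => i.
by apply: measurable_funX; exact: measurable_coord.
Qed.

Lemma measurable_fun_enorm d (X : measurableType d) (D : set X)
    (f : X -> 'rV[R]_n) :
  measurable_fun D f -> measurable_fun D (fun x => enorm (f x)).
Proof. exact: (measurableT_comp measurable_enorm). Qed.

Lemma measurable_fun_rVD d (X : measurableType d) (D : set X)
    (f g : X -> 'rV[R]_n) : measurable D ->
  measurable_fun D f -> measurable_fun D g ->
  measurable_fun D (fun x => f x + g x).
Proof.
move=> mD /measurable_fun_rVP - /(_ mD) mf /measurable_fun_rVP - /(_ mD) mg.
apply/measurable_fun_rVP => // i; under eq_fun do rewrite mxE.
exact: measurable_funD.
Qed.

Lemma measurable_fun_rVB d (X : measurableType d) (D : set X)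
    (f g : X -> 'rV[R]_n) : measurable D ->
  measurable_fun D f -> measurable_fun D g ->
  measurable_fun D (fun x => f x - g x).
Proof.
move=> mD /measurable_fun_rVP - /(_ mD) mf /measurable_fun_rVP - /(_ mD) mg.
apply/measurable_fun_rVP => // i; under eq_fun do rewrite 2!mxE.
exact: measurable_funB.
Qed.

End measurable_rV.

(** * The triangle and integrals with variable upper limit *)

Section triangle.
Context {R : realType}.
Variable T : R.
Local Notation mu := (@lebesgue_measure R).

Lemma measurable_triangle : measurable (triangle T : set (R * R)).
Proof.
pose t1 (z : R * R) := z.2; pose t2 (z : R * R) := z.1 - z.2.
pose t3 (z : R * R) := T - z.1.
have m1 : measurable_fun [set: R * R] t1 by exact: measurable_snd.
have m2 : measurable_fun [set: R * R] t2 by exact: measurable_funB.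
have m3 : measurable_fun [set: R * R] t3 by exact: measurable_funB.
have -> : triangle T = (t1 @^-1` `[0, +oo[) `&` (t2 @^-1` `[0, +oo[)
    `&` (t3 @^-1` `[0, +oo[).
  apply/seteqP; split=> z; rewrite /triangle /= !in_itv/= !andbT !subr_ge0.
    by move=> [? []].
  by move=> [[]].
by apply: measurableI; [apply: measurableI|]; rewrite -[X in measurable X]setTI;
  [apply: m1|apply: m2|apply: m3].
Qed.

Lemma triangle_section t :
  t \in `[0, T] -> forall s, triangle T (t, s) <-> `[0, t]%classic s.
Proof.
rewrite in_itv/= => /andP[t0 tT] s; rewrite /triangle /= in_itv/=.
by split=> [[-> [->]]|/andP[-> ->]].
Qed.

Lemma measurable_triangle_section d (Y : measurableType d) (F : R * R -> Y) t :
  t \in `[0, T] -> measurable_fun (triangle T) F ->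
  measurable_fun `[0, t] (fun s => F (t, s)).
Proof.
move=> tT mF; apply: (measurable_comp measurable_triangle _ mF).
  by move=> _ [s st <-]; exact/triangle_section.
by apply: measurable_funTS; exact: pair1_measurable.
Qed.

(** Extending H by 0 off the triangle turns the variable domain of integration into the whole line,
    where Tonelli gives measurability in t. *)
Lemma measurable_volterra_ge0 (H : R * R -> \bar R) :
  measurable_fun (triangle T) H ->
  (forall z, triangle T z -> 0 <= H z)%E ->
  measurable_fun `[0, T] (fun t => \int[mu]_(s in `[0%R, t]) H (t, s))%E.
Proof.
move=> mH H0.
have mHr : measurable_fun [set: R * R] (H \_ (triangle T)).
  by apply/(measurable_restrictT _ measurable_triangle); exact: mH.
have mI : measurable_fun `[0, T]
    (fun t => \int[mu]_s (H \_ (triangle T)) (t, s))%E.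
  apply: measurable_funTS.
  apply: (@measurable_integral2 R (fun t s => (H \_ (triangle T)) (t, s))).
    by under eq_fun do rewrite -surjective_pairing.
  by move=> t s; exact: erestrict_ge0.
apply: eq_measurable_fun mI => t.
rewrite inE /= => tT; rewrite [RHS]integral_mkcond; apply: eq_integral => s _.
rewrite !patchE; case: ifPn => [/set_mem/(triangle_section tT) ts|ts].
  by rewrite mem_set.
rewrite ifF//; apply/negP => /set_mem /(triangle_section tT) ts'.
by move/negP : ts; apply; exact: mem_set.
Qed.

(** Difference of the integrals of the positive and negative parts, followed by [fine], which is
    measurable. Those t at which the integral diverges are thus included. *)
Lemma measurable_volterra (H : R * R -> R) :
  measurable_fun (triangle T) H ->
  measurable_fun `[0, T] (fun t => \int[mu]_(s in `[0, t]) H (t, s)).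
Proof.
move=> mH; rewrite /Rintegral.
apply: (measurableT_comp (@fine_measurable R setT measurableT)).
have mE : measurable_fun (triangle T) (EFin \o H) by exact/measurable_EFinP.
have -> : (fun t => \int[mu]_(s in `[0%R, t]) (H (t, s))%:E)%E =
    ((fun t => \int[mu]_(s in `[0%R, t]) ((EFin \o H)^\+ (t, s))) \-
     (fun t => \int[mu]_(s in `[0%R, t]) ((EFin \o H)^\- (t, s))))%E.
  by apply/funext => t; rewrite [LHS]integralE; congr (_ - _)%E;
    apply: eq_integral => s _; rewrite ?funeposE ?funenegE.
apply: emeasurable_funB; apply: measurable_volterra_ge0 => //.
- exact: measurable_funepos.
- exact: measurable_funeneg.
Qed.

End triangle.

(** * Measurability of the coefficients along a trajectory *)

Section superposition.
Context {R : realType} {n d : nat}.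
Variables (T : R) (U : set 'rV[R]_d).

(** The preimage of B under f is the trace on the domain of a measurable set A, and U may be
    nonmeasurable. As (t, s, x(s), u(s)) stays in the domain for (t, s) in the triangle, membership
    in A alone decides, and only A is pulled back. *)
Lemma measurable_superposition (f : R -> R -> 'rV[R]_n -> 'rV[R]_d -> 'rV[R]_n)
    (x : R -> 'rV[R]_n) (u : R -> 'rV[R]_d) :
  measurable_coef U T f ->
  measurable_fun `[0, T] x -> measurable_fun `[0, T] u ->
  (forall t : R, t \in `[0, T] -> U (u t)) ->
  measurable_fun (triangle T) (fun z => f z.1 z.2 (x z.2) (u z.2)).
Proof.
move=> mf mx mu_ uU.
have mitv : measurable (`[0, T]%classic : set R) by exact: measurable_itv.
(* Measurability of x and u is known on [0, T] only, so they are extended by 0 to obtain a map [phi]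
   measurable on the whole plane. *)
pose ext k (v : R -> 'rV[R]_k) (s : R) : 'rV[R]_k := \row_i ((fun s =>
  v s ord0 i) \_ `[0, T]) s.
have mext k (v : R -> 'rV[R]_k) :
  measurable_fun `[0, T] v -> measurable_fun [set: R] (ext k v).
  move=> /(measurable_fun_rVP _ mitv) mv.
  apply/measurable_fun_rVP => // i.
  rewrite (_ : (fun _ => _) = (fun s => v s ord0 i) \_ `[0, T]).
    by apply/(measurable_restrictT _ mitv); exact: mv.
  by apply/funext => s; rewrite mxE.
have extE k (v : R -> 'rV[R]_k) s : s \in `[0, T] -> ext k v s = v s.
  by move=> sT; apply/rowP => i; rewrite mxE patchE mem_set.
pose phi (z : R * R) := (z.1, z.2, ext n x z.2, ext d u z.2).
have mphi : measurable_fun [set: R * R] phi.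
  apply: measurable_fun_pair; last first.
    by apply: (measurableT_comp (mext _ _ mu_)).
  apply: measurable_fun_pair; last first.
    by apply: (measurableT_comp (mext _ _ mx)).
  exact: measurable_fun_pair.
move=> _ B mB.
have [A mA AE] := mf B mB.
have -> : triangle T `&` (fun z => f z.1 z.2 (x z.2) (u z.2)) @^-1` B =
          triangle T `&` phi @^-1` A.
  have inT z : triangle T z -> z.2 \in `[0, T].
    by rewrite /triangle/= => -[z0 [zz zT]]; rewrite in_itv/= z0 (le_trans zz).
  apply/seteqP; split=> z [zT zB]; split=> //.
    have : (A `&` ((triangle T `*` [set: 'rV[R]_n]) `*` U)) (phi z).
      rewrite AE; split => /=; rewrite !extE ?inT//.
        split; last by apply: uU; exact: inT.
        by split => //; rewrite -surjective_pairing.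
    by case.
  have : (A `&` ((triangle T `*` [set: 'rV[R]_n]) `*` U)) (phi z).
    split => //=; rewrite !extE ?inT//; split; last by apply: uU; exact: inT.
    by split => //=; rewrite -surjective_pairing.
  by rewrite AE => -[_] /=; rewrite !extE ?inT.
apply: measurableI; first exact: measurable_triangle.
by rewrite -[X in measurable X]setTI; exact: mphi.
Qed.

End superposition.

(** * Calculus with integrals of p-th powers *)

Section Lp_functional.
Context {R : realType}.
Local Notation mu := (@lebesgue_measure R).
Variables (D : set R) (p : R).
Hypotheses (mD : measurable D) (p0 : 0 < p).
Implicit Types e : R -> \bar R.

Lemma measurable_fun_poweR e (q : R) : measurable_fun D e ->
  measurable_fun D (fun t => e t `^ q)%E.
Proof. by move=> me; apply: (measurableT_comp (measurable_poweR _)). Qed.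

Lemma ae_lty e : measurable_fun D e -> (forall t, 0 <= e t)%E ->
  (\int[mu]_(t in D) (e t `^ p) < +oo)%E ->
  {ae mu, forall t, D t -> (e t < +oo)%E}.
Proof.
move=> me e0 fin.
have ie : mu.-integrable D (fun t => e t `^ p)%E.
  apply/integrableP; split; first exact: measurable_fun_poweR.
  have -> // : (\int[mu]_(t in D) `|e t `^ p| = \int[mu]_(t in D) (e t `^ p))%E.
  by apply: eq_integral => t _; rewrite gee0_abs// poweR_ge0.
have fin_ae : {ae mu, forall t, D t -> (e t `^ p)%E \is a fin_num}.
  by apply: integrable_ae.
apply: filterS fin_ae => t fint Dt.
apply: (@lty_poweRy _ _ p); first by rewrite gt_eqF.
by rewrite -ge0_fin_numE ?poweR_ge0//; exact: fint.
Qed.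

Lemma Lp_addD_le e e' : measurable_fun D e -> (forall t, 0 <= e t)%E ->
  measurable_fun D e' -> (forall t, 0 <= e' t)%E ->
  (\int[mu]_(t in D) ((e t + e' t) `^ p) <=
   (2 `^ p)%:E * (\int[mu]_(t in D) (e t `^ p) + \int[mu]_(t in D) (e' t `^
     p)))%E.
Proof.
move=> me e0 me' e0'.
have mep := measurable_fun_poweR p me; have mep' := measurable_fun_poweR p me'.
rewrite -ge0_integralD//; try by move=> t _; exact: poweR_ge0.
rewrite -ge0_integralZl_EFin ?powR_ge0//; last 2 first.
- by move=> t _; rewrite adde_ge0 ?poweR_ge0.
- exact: emeasurable_funD.
apply: ge0_le_integral => //.
- by move=> t _; exact: poweR_ge0.
- by apply: measurable_fun_poweR; exact: emeasurable_funD.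
- by apply: emeasurable_funM => //; exact: emeasurable_funD.
- by move=> t _; apply: poweR_leD => //; exact: ltW.
Qed.

Lemma Lp_scaleE e (a : R) : 0 <= a ->
  measurable_fun D e -> (forall t, 0 <= e t)%E ->
  (\int[mu]_(t in D) ((a%:E * e t) `^ p) =
   (a `^ p)%:E * \int[mu]_(t in D) (e t `^ p))%E.
Proof.
move=> a0 me e0.
rewrite -ge0_integralZl_EFin ?powR_ge0//; last 2 first.
- by move=> t _; exact: poweR_ge0.
- exact: measurable_fun_poweR.
by apply: eq_integral => t _; rewrite poweRM ?lee_fin.
Qed.

Lemma Lp_le e e' : measurable_fun D e -> (forall t, 0 <= e t)%E ->
  measurable_fun D e' -> (forall t, 0 <= e' t)%E ->
  {ae mu, forall t, D t -> (e t <= e' t)%E} ->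
  (\int[mu]_(t in D) (e t `^ p) <= \int[mu]_(t in D) (e' t `^ p))%E.
Proof.
move=> me e0 me' e0' ee'.
apply: ae_le_integral => //; try by move=> t _; exact: poweR_ge0.
- exact: measurable_fun_poweR.
- exact: measurable_fun_poweR.
apply: filterS ee' => t ee' Dt; apply: gt0_ler_poweR; first exact: ltW.
- by rewrite in_itv/= leey e0.
- by rewrite in_itv/= leey e0'.
- exact: ee'.
Qed.

Lemma lte_scale (a : R) (x : \bar R) :
  0 <= a -> (x < +oo)%E -> (a%:E * x < +oo)%E.
Proof. by move=> a0 x_fin; apply: lte_mul_pinfty; rewrite ?lee_fin. Qed.

(** Bookkeeping of constants: it inserts a bound of the integrals, with constant c, into an estimate
    with constant b, and the two constants multiply. *)
Lemma affine_growth_le (a b c : R) (I S : \bar R) :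
  0 <= a -> 0 <= b -> 1 <= c ->
  (0 <= S)%E -> (I <= c%:E * S)%E ->
  (b%:E * (a%:E + I) <= (b * c)%:E * (a%:E + S))%E.
Proof.
move=> a0 b0 c1 S0 IS; rewrite EFinM -muleA; apply: lee_wpmul2l;
  rewrite ?lee_fin//.
rewrite ge0_muleDr ?lee_fin//; apply: leeD => //.
by rewrite -EFinM lee_fin ler_peMl.
Qed.

(** Meant for q = 1/p and the three terms of the stability estimate. Since 2^q >= 1, the third term
    can carry the same constant as the two that are split twice. *)
Lemma poweR_root3_le (a b e : \bar R) (q : R) : 0 <= q ->
  (0 <= a)%E -> (0 <= b)%E -> (0 <= e)%E ->
  ((a + b + e) `^ q <= (2 `^ q * 2 `^ q)%:E * (a `^ q + b `^ q + e `^ q))%E.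
Proof.
move=> q0 a0 b0 e0.
have ab0 : (0 <= a + b)%E by exact: adde_ge0.
have two : 1 <= 2 `^ q :> R by rewrite -{1}(powRr0 2) ler_powR// ler1n.
have abq : (0 <= a `^ q + b `^ q)%E by rewrite adde_ge0 ?poweR_ge0.
apply: (le_trans (poweR_leD ab0 e0 q0)).
rewrite EFinM -muleA; apply: lee_wpmul2l; first by rewrite lee_fin powR_ge0.
rewrite [leRHS]ge0_muleDr ?poweR_ge0//; apply: leeD; first exact: poweR_leD.
by rewrite -[leLHS]mul1e; apply: lee_wpmul2r; rewrite ?poweR_ge0 ?lee_fin.
Qed.

End Lp_functional.

(** * Vector-valued integrals *)

Section vector_integral.
Context {R : realType} {n : nat}.
Local Notation mu := (@lebesgue_measure R).
Local Notation c := (n.+1%:R : R).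

Lemma in_LpVP (T p : R) (x : R -> 'rV[R]_n) : 0 < p ->
  in_LpV T p x <-> measurable_fun `[0, T] x /\
    (\int[mu]_(t in `[0%R, T]) (enorm (x t) `^ p)%:E < +oo)%E.
Proof.
move=> p0.
have E : (\int[mu]_(t in `[0%R, T]) (`|enorm (x t)| `^ p)%:E =
          \int[mu]_(t in `[0%R, T]) (enorm (x t) `^ p)%:E)%E.
  by apply: eq_integral => t _; rewrite ger0_norm ?enorm_ge0.
rewrite /in_LpV; split=> [[mx /(in_LpP _ _ p0)[_]]|[mx fin]];
  first by rewrite E.
split=> //; apply/(in_LpP _ _ p0); split; last by rewrite E.
apply/(measurable_restrictT _ (measurable_itv _)).
exact: measurable_fun_enorm.
Qed.

Lemma LpV_normE (T p : R) (x : R -> 'rV[R]_n) : 0 < p ->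
  LpV_norm T p x =
  ((\int[mu]_(t in `[0%R, T]) (enorm (x t) `^ p)%:E) `^ p^-1)%E.
Proof.
move=> p0; rewrite /LpV_norm (Lp_normE _ _ p0); congr (_ `^ _)%E.
by apply: eq_integral => t _; rewrite ger0_norm ?enorm_ge0.
Qed.

(** Each coordinate is bounded by the integral of the norm, and passing from coordinates to the norm
    costs c. If the integral on the right diverges the bound is trivial. *)
Lemma enorm_vintegral_le (D : set R) (F : R -> 'rV[R]_n) :
  measurable D -> measurable_fun D F ->
  ((enorm (vintegral D F))%:E <= c%:E * \int[mu]_(s in D) (enorm (F s))%:E)%E.
Proof.
move=> mD mF.
set I := (\int[mu]_(s in D) (enorm (F s))%:E)%E.
have I0 : (0 <= I)%E by apply: integral_ge0 => s _; rewrite lee_fin enorm_ge0.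
have [Ifin|] := boolP (I \is a fin_num); last first.
  by rewrite ge0_fin_numE// -leNgt leye_eq => /eqP ->; rewrite gt0_muley ?leey.
rewrite -(fineK Ifin) -EFinM lee_fin; apply: enorm_le_coord => [|i].
  exact: fine_ge0.
rewrite mxE /Rintegral -lee_fin fineK//.
set J := (\int[mu]_(s in D) (F s ord0 i)%:E)%E.
have mFi : measurable_fun D (fun s => (F s ord0 i)%:E).
  by apply/measurable_EFinP; move: i {J}; apply/measurable_fun_rVP.
apply: (@le_trans _ _ (`|J|)%E); first by case: J => [r| |] /=;
  [exact: lexx|exact: leey|exact: leey].
apply: (le_trans (@le_abse_integral _ _ _ mu D (fun s =>
  (F s ord0 i)%:E) mD mFi)).
apply: ge0_le_integral => //.
- exact: measurableT_comp.
- by apply/measurable_EFinP; exact: measurable_fun_enorm.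
- by move=> s _; rewrite lee_fin ler_coord_enorm.
Qed.

Lemma vintegrable_enorm (D : set R) (F : R -> 'rV[R]_n) :
  measurable D -> measurable_fun D F ->
  (\int[mu]_(s in D) (enorm (F s))%:E < +oo)%E -> vintegrable D F.
Proof.
move=> mD mF fin i.
have mFi : measurable_fun D (fun s => (F s ord0 i)%:E).
  by apply/measurable_EFinP; move: i; apply/measurable_fun_rVP.
apply/integrableP; split => //; apply: le_lt_trans fin.
apply: ge0_le_integral => //.
- exact: measurableT_comp.
- by apply/measurable_EFinP; exact: measurable_fun_enorm.
- by move=> s _; rewrite lee_fin ler_coord_enorm.
Qed.

Lemma vintegralB (D : set R) (F G : R -> 'rV[R]_n) : measurable D ->
  vintegrable D F -> vintegrable D G ->
  vintegral D F - vintegral D G = vintegral D (fun s => F s - G s).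
Proof.
move=> mD iF iG; apply/rowP => i; rewrite !mxE.
have <- := @RintegralB _ _ _ mu D (fun s => F s ord0 i) (fun s =>
  G s ord0 i) mD (iF i) (iG i).
by apply: eq_Rintegral => s _; rewrite !mxE.
Qed.

(** Two uses of the triangle inequality give c^2, and the norm of each vector integral gives one
    more factor c. *)
Lemma enorm_add_vintegrals_le (a : 'rV[R]_n) (D : set R) (F G : R -> 'rV[R]_n) :
  measurable D -> measurable_fun D F -> measurable_fun D G ->
  ((enorm (a + vintegral D F + vintegral D G))%:E <= (c ^+ 3)%:E *
     ((enorm a)%:E + (\int[mu]_(s in D) (enorm (F s))%:E +
                      \int[mu]_(s in D) (enorm (G s))%:E)))%E.
Proof.
move=> mD mF mG.
have c1 : 1 <= c by rewrite ler1n.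
have c0 : 0 <= c by [].
set I := (\int[mu]_(s in D) (enorm (F s))%:E)%E.
set J := (\int[mu]_(s in D) (enorm (G s))%:E)%E.
have I0 : (0 <= I)%E by apply: integral_ge0 => s _; rewrite lee_fin enorm_ge0.
have J0 : (0 <= J)%E by apply: integral_ge0 => s _; rewrite lee_fin enorm_ge0.
set V := vintegral D F; set W := vintegral D G.
apply: (@le_trans _ _ ((c ^+ 2 * (enorm a + (enorm V + enorm W)))%:E)).
  rewrite lee_fin (le_trans (enormD_le _ _))//.
  rewrite expr2 -mulrA ler_wpM2l//.
  rewrite (@le_trans _ _ (c * (enorm a + enorm V) + c * enorm W))//.
    by rewrite lerD ?enormD_le// ler_peMl ?enorm_ge0.
  by rewrite -mulrDr addrA.
have -> : (c ^+ 3)%:E = ((c ^+ 2)%:E * c%:E)%E by rewrite -EFinM -exprSr.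
rewrite [leLHS]EFinM -muleA.
apply: lee_wpmul2l; first by rewrite lee_fin exprn_ge0.
rewrite ge0_muleDr; [|by rewrite lee_fin enorm_ge0|exact: adde_ge0].
rewrite EFinD; apply: leeD.
  by rewrite -EFinM lee_fin ler_peMl ?enorm_ge0.
by rewrite ge0_muleDr// EFinD leeD// enorm_vintegral_le.
Qed.

End vector_integral.

(** * Additivity and homogeneity of the convolution *)

Section convolution_linear.
Context {R : realType}.
Local Notation mu := (@lebesgue_measure R).
Variable k : R -> R.
Hypotheses (mk : measurable_fun [set: R] k) (k0 : forall x, 0 <= k x).

Lemma convolutionD (v w : R -> R) t :
  measurable_fun [set: R] v -> (forall x, 0 <= v x) ->
  measurable_fun [set: R] w -> (forall x, 0 <= w x) ->
  convolution k (v \+ w)%R t = (convolution k v t + convolution k w t)%E.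
Proof.
move=> mv v0 mw w0; rewrite /convolution -ge0_integralD//.
- by apply: eq_integral => s _; rewrite -EFinD mulrDr.
- by move=> s _; rewrite lee_fin mulr_ge0.
- by apply/measurable_EFinP/measurable_funM => //; exact: measurable_fun_shift.
- by move=> s _; rewrite lee_fin mulr_ge0.
- by apply/measurable_EFinP/measurable_funM => //; exact: measurable_fun_shift.
Qed.

Lemma convolutionZ (a : R) (w : R -> R) t : 0 <= a ->
  measurable_fun [set: R] w -> (forall x, 0 <= w x) ->
  convolution k (a \*o w) t = (a%:E * convolution k w t)%E.
Proof.
move=> a0 mw w0; rewrite /convolution -ge0_integralZl_EFin//.
- by apply: eq_integral => s _; rewrite -EFinM /= mulrCA.
- by move=> s _; rewrite lee_fin mulr_ge0.
- by apply/measurable_EFinP/measurable_funM => //; exact: measurable_fun_shift.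
Qed.

End convolution_linear.

Definition picard {R : realType} {n d : nat} (alpha : R)
    (f g : R -> R -> 'rV[R]_n -> 'rV[R]_d -> 'rV[R]_n)
    (x0 : R -> 'rV[R]_n) (u : R -> 'rV[R]_d) (x : R -> 'rV[R]_n) (t : R) :=
  x0 t + vintegral `[0, t] (singular_term alpha f x u t)
       + vintegral `[0, t] (regular_term g x u t).

(** The convolution and Gronwall estimates concern nonnegative scalar functions on the line that
    vanish outside [0, T]; this is how a trajectory enters them. *)
Definition restr_enorm {R : realType} {n : nat} (T : R) (x : R -> 'rV[R]_n) :
  R -> R :=
  (fun t => enorm (x t)) \_ `[0, T].

(** * Pointwise and L^p estimates for the Picard map *)

Section picard_estimates.
Context {R : realType} {n d : nat} {T p alpha : R}.
Context {U : set 'rV[R]_d} {u0 : 'rV[R]_d}.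
Context {f g : R -> R -> 'rV[R]_n -> 'rV[R]_d -> 'rV[R]_n} {K0 K : R -> R}.
Hypotheses (T_gt0 : 0 < T) (p_ge1 : 1 <= p) (alpha_gt0 : 0 < alpha)
    (alpha_lt1 : alpha < 1)
    (mf : measurable_coef U T f) (mg : measurable_coef U T g)
    (K0_ge0 : forall s : R, s \in `[0, T] -> 0 <= K0 s)
    (K_ge0 : forall s : R, s \in `[0, T] -> 0 <= K s)
    (LK0 : in_Lplus T (maxe (p / (1 + alpha * p))%:E 1%:E) K0)
    (LK : in_Lplus T (maxe (alpha^-1)%:E (hoelder_conjugate p%:E)) K)
    (mK0 : measurable_fun [set: R] (K0 \_ `[0, T]))
    (mK : measurable_fun [set: R] (K \_ `[0, T]))
    (fg_lip : forall t s, triangle T (t, s) ->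
      forall x x' u u', U u -> U u' ->
      enorm (f t s x u - f t s x' u') + enorm (g t s x u - g t s x' u')
        <= K s * (enorm (x - x') + enorm (u - u')))
    (fg_bound : forall t s, triangle T (t, s) -> forall u, U u ->
      enorm (f t s 0 u) + enorm (g t s 0 u) <= K0 s).
Local Notation mu := (@lebesgue_measure R).
Local Notation c := (n.+1%:R : R).
Local Notation k := (skernel alpha T).
Local Notation admissible := (admissible_control U u0 T p).

Let p_gt0 : 0 < p. Proof. exact: lt_le_trans ltr01 p_ge1. Qed.
Let mk := @measurable_skernel R alpha T.
Let k_ge0 := @skernel_ge0 R alpha T.

Lemma restr_enorm_ge0 m (x : R -> 'rV[R]_m) s : 0 <= restr_enorm T x s.
Proof. by apply: restrict_ge0 => t _; exact: enorm_ge0. Qed.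

Lemma measurable_restr_enorm m (x : R -> 'rV[R]_m) : measurable_fun `[0, T] x ->
  measurable_fun [set: R] (restr_enorm T x).
Proof.
move=> mx; apply/(measurable_restrictT _ (measurable_itv _)).
exact: measurable_fun_enorm.
Qed.

Lemma restr_enorm_out m (x : R -> 'rV[R]_m) t :
  t \notin `[0, T] -> restr_enorm T x t = 0.
Proof.
move=> tT; rewrite /restr_enorm patchE ifF//; apply/negP; rewrite inE/=.
exact/negP.
Qed.

Lemma restr_enorm_in m (x : R -> 'rV[R]_m) t :
  t \in `[0, T] -> restr_enorm T x t = enorm (x t).
Proof. by move=> tT; rewrite /restr_enorm patchE mem_set. Qed.

Let Kr := K \_ `[0, T].
Let K0r := K0 \_ `[0, T].
Let Kr_ge0 s : 0 <= Kr s.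
Proof. by apply: restrict_ge0 => t /= tT; exact: K_ge0. Qed.
Let K0r_ge0 s : 0 <= K0r s.
Proof. by apply: restrict_ge0 => t /= tT; exact: K0_ge0. Qed.

Lemma measurable_singular_term x u : measurable_fun `[0, T] x -> admissible u ->
  measurable_fun (triangle T) (fun z => singular_term alpha f x u z.1 z.2).
Proof.
move=> mx [mu_ uU _].
have := measurable_superposition mf mx mu_ uU.
move=> /(measurable_fun_rVP _ (measurable_triangle T)) mF.
apply/(measurable_fun_rVP _ (measurable_triangle T)) => i.
rewrite /singular_term; under eq_fun do rewrite mxE.
apply: measurable_funM => //.
apply: measurable_funTS; under eq_fun do rewrite -powRN.
by apply: (@measurable_fun_sub2 R (fun x => x `^ (- (1 - alpha)))).
Qed.

Lemma measurable_regular_term x u : measurable_fun `[0, T] x -> admissible u ->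
  measurable_fun (triangle T) (fun z => regular_term g x u z.1 z.2).
Proof.
by move=> mx [mu_ uU _]; exact: measurable_superposition mg mx mu_ uU.
Qed.

Lemma measurable_picard x0 u x : measurable_fun `[0, T] x0 ->
  measurable_fun `[0, T] x -> admissible u ->
  measurable_fun `[0, T] (picard alpha f g x0 u x).
Proof.
move=> mx0 mx au.
have mD : measurable (`[0, T]%classic : set R) by exact: measurable_itv.
apply: measurable_fun_rVD => //; first apply: measurable_fun_rVD => //.
  apply/measurable_fun_rVP => // i.
  rewrite (_ : (fun _ => _) = fun t =>
    \int[mu]_(s in `[0, t]) singular_term alpha f x u t s ord0 i);
    last by apply/funext => t; rewrite mxE.
  apply: (@measurable_volterra R T (fun z =>
    singular_term alpha f x u z.1 z.2 ord0 i)).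
  move: i; apply/measurable_fun_rVP; first exact: measurable_triangle.
  exact: measurable_singular_term.
apply/measurable_fun_rVP => // i.
rewrite (_ : (fun _ => _) = fun t =>
  \int[mu]_(s in `[0, t]) regular_term g x u t s ord0 i);
  last by apply/funext => t; rewrite mxE.
apply: (@measurable_volterra R T (fun z => regular_term g x u z.1 z.2 ord0 i)).
move: i; apply/measurable_fun_rVP; first exact: measurable_triangle.
exact: measurable_regular_term.
Qed.

Lemma singular_section x u t : measurable_fun `[0, T] x -> admissible u ->
  t \in `[0, T] -> measurable_fun `[0, t] (singular_term alpha f x u t).
Proof.
move=> mx au tT.
exact: (measurable_triangle_section tT (measurable_singular_term mx au)).
Qed.

Lemma regular_section x u t : measurable_fun `[0, T] x -> admissible u ->
  t \in `[0, T] -> measurable_fun `[0, t] (regular_term g x u t).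
Proof.
move=> mx au tT.
exact: (measurable_triangle_section tT (measurable_regular_term mx au)).
Qed.

(** [source] majorizes what f and g contribute at x = 0, and [feedback] what their Lipschitz
    dependence on x adds. *)
Definition source (t : R) : \bar R := convolution k K0r t.
Definition feedback (x : R -> 'rV[R]_n) (t : R) : \bar R :=
  convolution k (Kr \* restr_enorm T x)%R t.

Lemma source_ge0 t : (0 <= source t)%E.
Proof. exact: convolution_ge0. Qed.

Lemma feedback_ge0 x t : (0 <= feedback x t)%E.
Proof.
by apply: convolution_ge0 => // s; rewrite mulr_ge0 ?restr_enorm_ge0.
Qed.

(** Comparison with the values at x = 0 and the same control: both coefficients are then bounded by
    c (K0 + K |x|), and both integral kernels by k. *)
Lemma growth_le x u t : measurable_fun `[0, T] x -> admissible u ->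
  t \in `[0, T] ->
  (\int[mu]_(s in `[0%R, t]) (enorm (singular_term alpha f x u t s))%:E +
   \int[mu]_(s in `[0%R, t]) (enorm (regular_term g x u t s))%:E <=
   c%:E * (source t + feedback x t))%E.
Proof.
move=> mx au tT; have [mu_ uU _] := au.
have mS := singular_section mx au tT; have mG := regular_section mx au tT.
rewrite -ge0_integralD//; first last.
- by apply/measurable_EFinP; exact: measurable_fun_enorm.
- by move=> s _; rewrite lee_fin enorm_ge0.
- by apply/measurable_EFinP; exact: measurable_fun_enorm.
- by move=> s _; rewrite lee_fin enorm_ge0.
have mKx : measurable_fun [set: R] (Kr \* restr_enorm T x)%R.
  by apply: measurable_funM => //; exact: measurable_restr_enorm.
have Kx0 s : 0 <= (Kr \* restr_enorm T x)%R s by rewrite mulr_ge0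
  ?restr_enorm_ge0.
rewrite /source /feedback -convolutionD// -convolutionZ//; last 2 first.
- exact: measurable_funD.
- by move=> s; rewrite addr_ge0.
pose w s := c * (K0 s + K s * enorm (x s)).
have <- : w \_ `[0, T] = c \*o (K0r \+ (Kr \* restr_enorm T x))%R.
  apply/funext => s; rewrite /w /K0r /Kr /restr_enorm /= !patchE.
  by case: ifP => // _; rewrite mul0r addr0 mulr0.
rewrite convolution_skernelE//.
have mw : measurable_fun [set: R] (w \_ `[0, T]).
  rewrite (_ : w \_ `[0, T] = c \*o (K0r \+ (Kr \* restr_enorm T x))%R).
    by apply: measurable_funM => //; exact: measurable_funD.
  apply/funext => s; rewrite /w /K0r /Kr /restr_enorm /= !patchE.
  by case: ifP => // _; rewrite mul0r addr0 mulr0.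
have sub : `[0, t] `<=` `[0, T].
  by apply: subset_itvl; rewrite bnd_simp; move: tT;
    rewrite in_itv/= => /andP[].
apply: ge0_le_integral => //.
- by move=> s _; rewrite -EFinD lee_fin addr_ge0 ?enorm_ge0.
- by apply: emeasurable_funD; apply/measurable_EFinP;
  exact: measurable_fun_enorm.
- apply/measurable_EFinP; apply: measurable_funM.
    apply: measurable_funD => //; apply: measurable_funTS.
    under eq_fun do rewrite -powRN.
    by apply: (@measurable_fun_shift R (fun x => x `^ (- (1 - alpha)))).
  apply: (measurable_funS (measurable_itv _) sub).
  exact/(measurable_restrictT _ (measurable_itv _)).
move=> s st; rewrite -EFinD lee_fin.
have ts : triangle T (t, s) by exact/triangle_section.
have Us : U (u s) by apply: uU; exact: sub.
have := fg_lip ts (x s) 0 Us Us; rewrite !subrr enorm0 addr0 subr0 => L.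
have B := fg_bound ts Us.
have tri (v v' : 'rV[R]_n) : enorm v <= c * (enorm (v - v') + enorm v').
  by rewrite -{1}(subrK v' v); exact: enormD_le.
have fx := tri (f t s (x s) (u s)) (f t s 0 (u s)).
have gx := tri (g t s (x s) (u s)) (g t s 0 (u s)).
rewrite /singular_term /regular_term enormZ.
have k10 : 0 <= ((t - s) `^ (1 - alpha))^-1 by rewrite invr_ge0 powR_ge0.
rewrite ger0_norm//.
set a := enorm (f t s (x s) (u s)) in fx *.
set b := enorm (g t s (x s) (u s)) in gx *.
have a0 : 0 <= a := enorm_ge0 _; have b0 : 0 <= b := enorm_ge0 _.
(* The hypotheses bound only the sum of the terms for f and g, so the two kernels are first replaced
   by their sum. *)
apply: (@le_trans _ _ ((((t - s) `^ (1 - alpha))^-1 + 1) * (a + b))).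
  rewrite mulrDl mul1r mulrDr -!addrA lerD2l addrA lerDr addr_ge0//.
  exact: mulr_ge0.
apply: ler_wpM2l; first exact: addr_ge0.
apply: (le_trans (lerD fx gx)); rewrite /w -mulrDr; apply: ler_wpM2l => //.
rewrite addrACA addrC; exact: lerD.
Qed.

(** Together with [control_gap_g], the inner integrals of the stability estimate, written so as to
    unfold to the expressions of the final statement. *)
Definition control_gap_f (x : R -> 'rV[R]_n) (u u' : R -> 'rV[R]_d) t :
  \bar R :=
  (\int[mu]_(s in `[0%R, t]) (enorm (f t s (x s) (u s) - f t s (x s) (u' s))
     / (t - s) `^ (1 - alpha))%R%:E)%E.

Definition control_gap_g (x : R -> 'rV[R]_n) (u u' : R -> 'rV[R]_d) t :
  \bar R :=
  (\int[mu]_(s in `[0%R, t])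
     (enorm (g t s (x s) (u s) - g t s (x s) (u' s))%R)%:E)%E.

(** The difference is split at (x(s), u'(s)): first the control changes with the state x fixed,
    which gives the gaps, then the state changes with the control u' fixed, which gives the
    Lipschitz term. This is why the gaps are evaluated along x. *)
Lemma difference_le x x' u u' t : measurable_fun `[0, T] x ->
  measurable_fun `[0, T] x' -> admissible u -> admissible u' ->
  t \in `[0, T] ->
  (\int[mu]_(s in `[0%R, t]) (enorm (singular_term alpha f x u t s -
      singular_term alpha f x' u' t s)%R)%:E +
   \int[mu]_(s in `[0%R, t]) (enorm (regular_term g x u t s -
      regular_term g x' u' t s)%R)%:E <=
   c%:E * (control_gap_f x u u' t + control_gap_g x u u' t +
           feedback (fun s => x s - x' s)%R t))%E.
Proof.
move=> mx mx' au au' tT; have [mu_ uU _] := au; have [mu_' uU' _] := au'.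
have sub : `[0, t] `<=` `[0, T].
  by apply: subset_itvl; rewrite bnd_simp; move: tT;
    rewrite in_itv/= => /andP[].
have mitv : measurable (`[0, t]%classic : set R) by exact: measurable_itv.
have mS := singular_section mx au tT; have mG := regular_section mx au tT.
have mS' := singular_section mx' au' tT; have mG' := regular_section mx' au' tT.
have mSx := singular_section mx au' tT; have mGx := regular_section mx au' tT.
have mdx : measurable_fun `[0, T] (fun s => x s - x' s).
  by apply: measurable_fun_rVB.
have mk1 : measurable_fun `[0, t] (fun s => ((t - s) `^ (1 - alpha))^-1).
  apply: measurable_funTS; under eq_fun do rewrite -powRN.
  by apply: (@measurable_fun_shift R (fun x => x `^ (- (1 - alpha)))).
have k10 s : 0 <= ((t - s) `^ (1 - alpha))^-1 by rewrite invr_ge0 powR_ge0.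
have mgap : measurable_fun `[0, t] (fun s =>
    enorm (f t s (x s) (u s) - f t s (x s) (u' s)) / (t - s) `^ (1 - alpha)).
  rewrite (_ : (fun _ => _) = fun s => enorm (singular_term alpha f x u t s -
      singular_term alpha f x u' t s)).
    by apply: measurable_fun_enorm; apply: measurable_fun_rVB.
  apply/funext => s; rewrite /singular_term -scalerBr enormZ ger0_norm//.
  by rewrite mulrC.
have mgapg : measurable_fun `[0, t] (fun s =>
    enorm (g t s (x s) (u s) - g t s (x s) (u' s))).
  apply: measurable_fun_enorm; exact: (measurable_fun_rVB mitv mG mGx).
pose w s := K s * enorm (x s - x' s).
have wE : w \_ `[0, T] = (Kr \* restr_enorm T (fun s => x s - x' s))%R.
  apply/funext => s; rewrite /w /Kr /restr_enorm /= !patchE.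
  by case: ifP => // _; rewrite mul0r.
have mw : measurable_fun [set: R] (w \_ `[0, T]).
  by rewrite wE; apply: measurable_funM => //; exact: measurable_restr_enorm.
have mwt : measurable_fun `[0, t] w.
  apply: (measurable_funS (measurable_itv _) sub).
  exact/(measurable_restrictT _ (measurable_itv _)).
have w0 s : `[0, t]%classic s -> 0 <= w s.
  by move=> st; rewrite mulr_ge0 ?enorm_ge0 ?K_ge0//; exact: sub.
rewrite /control_gap_f /control_gap_g /feedback -wE convolution_skernelE//.
have mkw : measurable_fun `[0, t] (fun s =>
  (((t - s) `^ (1 - alpha))^-1 + 1) * w s).
  by apply: measurable_funM => //; exact: measurable_funD.
have gap0 s : 0 <= enorm (f t s (x s) (u s) - f t s (x s) (u' s)) / (t - s) `^
  (1 - alpha).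
  by rewrite mulr_ge0 ?enorm_ge0.
have kw0 s : `[0, t]%classic s -> 0 <= (((t - s) `^ (1 - alpha))^-1 + 1) * w s.
  by move=> st; rewrite mulr_ge0 ?w0// addr_ge0.
rewrite -ge0_integralD//; first last.
- by apply/measurable_EFinP; apply: measurable_fun_enorm;
  apply: measurable_fun_rVB.
- by move=> s _; rewrite lee_fin enorm_ge0.
- by apply/measurable_EFinP; apply: measurable_fun_enorm;
  apply: measurable_fun_rVB.
- by move=> s _; rewrite lee_fin enorm_ge0.
rewrite -ge0_integralD//; first last.
- exact/measurable_EFinP.
- by move=> s _; rewrite lee_fin enorm_ge0.
- exact/measurable_EFinP.
- by move=> s _; rewrite lee_fin.
rewrite -ge0_integralD//; first last.
- exact/measurable_EFinP.
- by apply: emeasurable_funD; exact/measurable_EFinP.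
- by move=> s _; rewrite -EFinD lee_fin addr_ge0 ?enorm_ge0.
rewrite -ge0_integralZl_EFin//; first last.
- by apply: emeasurable_funD; [apply: emeasurable_funD|];
  exact/measurable_EFinP.
- by move=> s st; rewrite -!EFinD lee_fin !addr_ge0 ?enorm_ge0 ?kw0.
apply: ge0_le_integral => //.
- by move=> s _; rewrite -EFinD lee_fin addr_ge0 ?enorm_ge0.
- by apply: emeasurable_funD; apply/measurable_EFinP;
  apply: measurable_fun_enorm;
    apply: measurable_fun_rVB.
- by apply: emeasurable_funM => //; apply: emeasurable_funD;
    [apply: emeasurable_funD|]; exact/measurable_EFinP.
move=> s st; rewrite -!EFinD -EFinM lee_fin.
have ts : triangle T (t, s) by exact/triangle_section.
have Us : U (u s) by apply: uU; exact: sub.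
have Us' : U (u' s) by apply: uU'; exact: sub.
have := fg_lip ts (x s) (x' s) Us' Us'; rewrite subrr enorm0 addr0 => L.
have tri (v y v' : 'rV[R]_n) :
  enorm (v - v') <= c * (enorm (v - y) + enorm (y - v')).
  by rewrite -{1}(subrK y v) -addrA; exact: enormD_le.
have fx := tri (f t s (x s) (u s)) (f t s (x s) (u' s)) (f t s (x' s) (u' s)).
have gx := tri (g t s (x s) (u s)) (g t s (x s) (u' s)) (g t s (x' s) (u' s)).
rewrite /singular_term /regular_term -scalerBr enormZ ger0_norm// /w.
set k1 := _^-1 in k10 *; have {}k10 : 0 <= k1 by exact: k10.
move: L fx gx.
set Df := enorm (f t s (x s) (u s) - f t s (x s) (u' s)).
set Dg := enorm (g t s (x s) (u s) - g t s (x s) (u' s)).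
set Lf := enorm (f t s (x s) (u' s) - _);
  set Lg := enorm (g t s (x s) (u' s) - _).
set W := K s * _.
have Lf0 : 0 <= Lf := enorm_ge0 _; have Lg0 : 0 <= Lg := enorm_ge0 _.
move=> L fx gx.
apply: (@le_trans _ _ (k1 * (c * (Df + Lf)) + c * (Dg + Lg))).
  by apply: lerD => //; exact: ler_wpM2l.
have -> : k1 * (c * (Df + Lf)) + c * (Dg + Lg) =
    c * (Df * k1 + Dg + (k1 * Lf + Lg)) by ring.
apply: ler_wpM2l => //; rewrite lerD2l mulrDl mul1r.
by apply: lerD; [apply: ler_wpM2l => //|]; lra.
Qed.

Local Notation N x := (\int[mu]_(t in `[0%R, T]) (enorm (x t) `^ p)%:E)%E.
Local Notation IT := (`[0%R, T]%classic : set R).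
Let mIT : measurable IT. Proof. exact: measurable_itv. Qed.

Lemma measurable_source : measurable_fun [set: R] source.
Proof. exact: measurable_convolution. Qed.

Lemma measurable_feedback x : measurable_fun `[0, T] x ->
  measurable_fun [set: R] (feedback x).
Proof.
move=> mx; apply: measurable_convolution => //.
  by apply: measurable_funM => //; exact: measurable_restr_enorm.
by move=> s; rewrite mulr_ge0 ?restr_enorm_ge0.
Qed.

Lemma source_Lp : (\int[mu]_(t in `[0%R, T]) (source t `^ p) < +oo)%E.
Proof. exact: convolution_source_fin. Qed.

Lemma Kr_smoothing : smoothing p k Kr.
Proof. exact: smoothing_coefficient. Qed.

Lemma integral_restr_enorm (x : R -> 'rV[R]_n) :
  (\int[mu]_(t in `[0%R, T]) (restr_enorm T x t `^ p)%:E = N x)%E.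
Proof.
by apply: eq_integral => t; rewrite inE /= => tT; rewrite restr_enorm_in.
Qed.

Lemma integralT_restr_enorm (x : R -> 'rV[R]_n) :
  (\int[mu]_t (restr_enorm T x t `^ p)%:E = N x)%E.
Proof.
rewrite (@integral_powR_restrict _ _ _ (fun t => enorm (x t)) p_gt0).
  by apply: eq_integral => t _; rewrite ger0_norm ?enorm_ge0.
by move=> s _; exact: enorm_ge0.
Qed.

Lemma integral_enorm_poweR (x : R -> 'rV[R]_n) :
  N x = (\int[mu]_(t in `[0%R, T]) ((enorm (x t))%:E `^ p))%E.
Proof. by []. Qed.

Lemma feedback_bounded : exists2 C : R, 0 <= C & forall x : R -> 'rV[R]_n,
  measurable_fun `[0, T] x ->
  (\int[mu]_(t in `[0%R, T]) (feedback x t `^ p) <= C%:E * N x)%E.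
Proof.
have [C C0 HC] := smoothing_bounded T p_gt0 mk k_ge0 mK Kr_ge0 Kr_smoothing.
exists C => // x mx; rewrite -integral_restr_enorm.
apply: HC; [exact: measurable_restr_enorm|exact: restr_enorm_ge0|exact:
  restr_enorm_out].
Qed.

Lemma growth_ae x u : in_LpV T p x -> admissible u ->
  {ae mu, forall t, `[0, T]%classic t ->
    (source t < +oo)%E /\ (feedback x t < +oo)%E}.
Proof.
move=> /(in_LpVP _ _ p_gt0)[mx fin] au.
have [C C0 HC] := feedback_bounded.
have h1 : {ae mu, forall t, `[0, T]%classic t -> (source t < +oo)%E}.
  apply: (ae_lty mIT p_gt0 _ source_ge0 source_Lp).
  exact: measurable_funTS measurable_source.
have h2 : {ae mu, forall t, `[0, T]%classic t -> (feedback x t < +oo)%E}.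
  apply: (ae_lty mIT p_gt0 _ (feedback_ge0 x)).
    exact: measurable_funTS (measurable_feedback mx).
  by apply: (le_lt_trans (HC x mx)); exact: lte_scale C0 fin.
by apply: filterS2 h1 h2 => t a b tT; split; [exact: a|exact: b].
Qed.

(** [growth_le] bounds both integrals by functions whose p-th powers are integrable, hence which are
    finite almost everywhere. *)
Lemma terms_integrable x u : in_LpV T p x -> admissible u ->
  {ae mu, forall t, t \in `[0, T] ->
    vintegrable `[0, t] (singular_term alpha f x u t) /\
    vintegrable `[0, t] (regular_term g x u t)}.
Proof.
move=> Lx au; have [mx _] := Lx.
apply: filterS (growth_ae Lx au) => t fin tT.
have [fs ff] := fin tT.
have lty : (c%:E * (source t + feedback x t) < +oo)%E.
  by apply: lte_scale => //; exact: lte_add_pinfty fs ff.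
have g0 (F : R -> 'rV[R]_n) :
  (0 <= \int[mu]_(s in `[0%R, t]) (enorm (F s))%:E)%E.
  by apply: integral_ge0 => s _; rewrite lee_fin enorm_ge0.
have {lty}lty := le_lt_trans (growth_le mx au tT) lty.
have mD : measurable (`[0, t]%classic : set R) by exact: measurable_itv.
split; apply: (vintegrable_enorm mD).
- exact: singular_section.
- by apply: le_lt_trans lty; rewrite leeDl.
- exact: regular_section.
- by apply: le_lt_trans lty; rewrite leeDr.
Qed.

Lemma picard_le x0 u x t : measurable_fun `[0, T] x -> admissible u ->
  t \in `[0, T] ->
  ((enorm (picard alpha f g x0 u x t))%:E <=
   (c ^+ 4)%:E * ((enorm (x0 t))%:E + source t + feedback x t))%E.
Proof.
move=> mx au tT.
have mD : measurable (`[0, t]%classic : set R) by exact: measurable_itv.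
have c0 : 0 <= c by [].
have := enorm_add_vintegrals_le (x0 t) mD (singular_section mx au tT)
  (regular_section mx au tT).
move=> /le_trans; apply.
have sf0 : (0 <= source t + feedback x t)%E.
  by apply: adde_ge0; [exact: source_ge0|exact: feedback_ge0].
rewrite -(addeA (enorm (x0 t))%:E (source t)) [in leRHS]exprSr.
apply: affine_growth_le sf0 (growth_le mx au tT); rewrite ?enorm_ge0 ?ler1n//.
Qed.

Lemma control_gap_f_ge0 x u u' t : (0 <= control_gap_f x u u' t)%E.
Proof.
by apply: integral_ge0 => s _;
  rewrite lee_fin mulr_ge0 ?enorm_ge0// invr_ge0 powR_ge0.
Qed.

Lemma control_gap_g_ge0 x u u' t : (0 <= control_gap_g x u u' t)%E.
Proof. by apply: integral_ge0 => s _; rewrite lee_fin enorm_ge0. Qed.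

Lemma control_gap_f_refl x u t : control_gap_f x u u t = 0%E.
Proof.
by rewrite /control_gap_f integral0_eq// => s _; rewrite subrr enorm0 mul0r.
Qed.

Lemma control_gap_g_refl x u t : control_gap_g x u u t = 0%E.
Proof.
by rewrite /control_gap_g integral0_eq// => s _; rewrite subrr enorm0.
Qed.

Lemma measurable_control_gap_f x u u' : measurable_fun `[0, T] x ->
  admissible u -> admissible u' -> measurable_fun `[0,
    T] (control_gap_f x u u').
Proof.
move=> mx au au'.
apply: (@measurable_volterra_ge0 R T (fun z => (enorm (f z.1 z.2 (x z.2) (u z.2)
  - f z.1 z.2 (x z.2) (u' z.2)) / (z.1 - z.2) `^ (1 - alpha))%:E)); last first.
  by move=> z _; rewrite lee_fin mulr_ge0 ?enorm_ge0// invr_ge0 powR_ge0.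
apply/measurable_EFinP.
rewrite (_ : (fun _ => _) = fun z : R * R =>
  enorm (singular_term alpha f x u z.1 z.2 -
    singular_term alpha f x u' z.1 z.2)).
  apply: measurable_fun_enorm; apply: measurable_fun_rVB.
  - exact: measurable_triangle.
  - exact: measurable_singular_term.
  - exact: measurable_singular_term.
apply/funext => z; rewrite /singular_term -scalerBr enormZ ger0_norm ?invr_ge0
  ?powR_ge0//.
by rewrite mulrC.
Qed.

Lemma measurable_control_gap_g x u u' : measurable_fun `[0, T] x ->
  admissible u -> admissible u' -> measurable_fun `[0,
    T] (control_gap_g x u u').
Proof.
move=> mx au au'.
apply: (@measurable_volterra_ge0 R T (fun z => (enorm (g z.1 z.2 (x z.2) (u z.2)
  - g z.1 z.2 (x z.2) (u' z.2)))%:E)); last first.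
  by move=> z _; rewrite lee_fin enorm_ge0.
apply/measurable_EFinP; apply: measurable_fun_enorm; apply: measurable_fun_rVB.
- exact: measurable_triangle.
- exact: (@measurable_regular_term x u).
- exact: (@measurable_regular_term x u').
Qed.

(** Unlike [picard_le], this is claimed almost everywhere: the difference of the integrals is turned
    into the integral of the difference at those t where all of them exist. *)
Lemma picard_sub_le x0 x0' u u' x x' :
  in_LpV T p x -> in_LpV T p x' -> admissible u -> admissible u' ->
  {ae mu, forall t, t \in `[0, T] ->
    ((enorm (picard alpha f g x0 u x t - picard alpha f g x0' u' x' t))%:E <=
     (c ^+ 4)%:E * ((enorm (x0 t - x0' t)%R)%:E +
       (control_gap_f x u u' t + control_gap_g x u u' t +
        feedback (fun s => x s - x' s)%R t)))%E}.
Proof.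
move=> Lx Lx' au au'; have [mx _] := Lx; have [mx' _] := Lx'.
apply: filterS2 (terms_integrable Lx au) (terms_integrable Lx' au').
move=> t int int' tT; have {int}[iS iG] := int tT;
  have {int'}[iS' iG'] := int' tT.
have mD : measurable (`[0, t]%classic : set R) by exact: measurable_itv.
have c0 : 0 <= c by [].
have -> : picard alpha f g x0 u x t - picard alpha f g x0' u' x' t =
    (x0 t - x0' t) +
    vintegral `[0, t] (fun s => singular_term alpha f x u t s -
                                singular_term alpha f x' u' t s) +
    vintegral `[0, t] (fun s =>
      regular_term g x u t s - regular_term g x' u' t s).
  rewrite -!vintegralB// /picard !opprD !addrA.
  by rewrite (addrAC _ _ (- x0' t)) (addrAC _ _ (- x0' t))
    (addrAC _ (vintegral _ (regular_term g x u t)) (- vintegral _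
      (singular_term _ _ x' _ _))).
have mS := measurable_fun_rVB mD (singular_section mx au tT) (singular_section
  mx' au' tT).
have mG := measurable_fun_rVB mD (regular_section mx au tT) (regular_section
  mx' au' tT).
have /le_trans := enorm_add_vintegrals_le (x0 t - x0' t) mD mS mG; apply.
set G := (_ + _ + feedback _ t)%E.
have G0 : (0 <= G)%E.
  apply: adde_ge0; last exact: feedback_ge0.
  by apply: adde_ge0; [exact: control_gap_f_ge0|exact: control_gap_g_ge0].
rewrite [in leRHS]exprSr;
  apply: affine_growth_le G0 (difference_le mx mx' au au' tT);
  rewrite ?enorm_ge0 ?ler1n//.
Qed.

Lemma in_LpVB (x y : R -> 'rV[R]_n) : in_LpV T p x -> in_LpV T p y ->
  in_LpV T p (fun t => x t - y t).
Proof.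
move=> /(in_LpVP _ _ p_gt0)[mx finx] /(in_LpVP _ _ p_gt0)[my finy].
apply/(in_LpVP _ _ p_gt0); split; first exact: measurable_fun_rVB.
have mnx : measurable_fun `[0, T] (fun t => (enorm (x t))%:E).
  by apply/measurable_EFinP; exact: measurable_fun_enorm.
have mny : measurable_fun `[0, T] (fun t => (enorm (y t))%:E).
  by apply/measurable_EFinP; exact: measurable_fun_enorm.
have nx0 t : (0 <= (enorm (x t))%:E)%E by rewrite lee_fin enorm_ge0.
have ny0 t : (0 <= (enorm (y t))%:E)%E by rewrite lee_fin enorm_ge0.
have mD : measurable_fun `[0, T] (fun t =>
  (enorm (x t))%:E + (enorm (y t))%:E)%E.
  exact: emeasurable_funD.
apply: (@le_lt_trans _ _ (\int[mu]_(t in `[0%R, T])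
    (c%:E * ((enorm (x t))%:E + (enorm (y t))%:E)) `^ p)%E).
  rewrite integral_enorm_poweR; apply: (Lp_le mIT p_gt0).
  - apply/measurable_EFinP; apply: measurable_fun_enorm;
    exact: measurable_fun_rVB.
  - by move=> t; rewrite lee_fin enorm_ge0.
  - exact: emeasurable_funM.
  - by move=> t; rewrite -EFinD -EFinM lee_fin mulr_ge0// addr_ge0 ?enorm_ge0.
  - by apply: aeW => t _; rewrite -EFinD -EFinM lee_fin enormB_le.
have c0 : 0 <= c by [].
have nxy0 t : (0 <= (enorm (x t))%:E + (enorm (y t))%:E)%E by exact: adde_ge0.
rewrite (Lp_scaleE p mIT c0 mD nxy0).
apply: lte_scale; first exact: powR_ge0.
apply: (le_lt_trans (Lp_addD_le mIT p_gt0 mnx nx0 mny ny0)).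
apply: lte_scale; first exact: powR_ge0.
exact: lte_add_pinfty finx finy.
Qed.

(** Supplies the finiteness that the Gronwall inequality requires of the iterates and of their
    increments. *)
Lemma in_LpV_picard x0 u x : in_LpV T p x0 -> in_LpV T p x -> admissible u ->
  in_LpV T p (picard alpha f g x0 u x).
Proof.
move=> /(in_LpVP _ _ p_gt0)[mx0 fin0] /(in_LpVP _ _ p_gt0)[mx fin] au.
have mP := measurable_picard mx0 mx au.
apply/(in_LpVP _ _ p_gt0); split; first exact: mP.
have mn0 : measurable_fun `[0, T] (fun t => (enorm (x0 t))%:E).
  by apply/measurable_EFinP; exact: measurable_fun_enorm.
have n0 t : (0 <= (enorm (x0 t))%:E)%E by rewrite lee_fin enorm_ge0.
have ms : measurable_fun `[0,
  T] source by exact: measurable_funTS measurable_source.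
have mb : measurable_fun `[0, T] (feedback x).
  exact: measurable_funTS (measurable_feedback mx).
have m1 : measurable_fun `[0, T] (fun t => (enorm (x0 t))%:E + source t)%E.
  exact: emeasurable_funD.
have m2 : measurable_fun `[0, T] (fun t =>
  (enorm (x0 t))%:E + source t + feedback x t)%E.
  exact: emeasurable_funD.
have p1 t : (0 <= (enorm (x0 t))%:E + source t)%E by rewrite adde_ge0
  ?source_ge0.
have p2 t : (0 <= (enorm (x0 t))%:E + source t + feedback x t)%E.
  by rewrite adde_ge0 ?feedback_ge0.
have c4 : 0 <= c ^+ 4 by rewrite exprn_ge0.
apply: (@le_lt_trans _ _ (\int[mu]_(t in `[0%R, T])
    ((c ^+ 4)%:E * ((enorm (x0 t))%:E + source t + feedback x t)) `^ p)%E).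
  rewrite integral_enorm_poweR; apply: (Lp_le mIT p_gt0).
  - by apply/measurable_EFinP; exact: measurable_fun_enorm.
  - by move=> t; rewrite lee_fin enorm_ge0.
  - exact: emeasurable_funM.
  - by move=> t; rewrite mule_ge0 ?lee_fin.
  - by apply: aeW => t tT; exact: picard_le.
rewrite (Lp_scaleE p mIT c4 m2 p2).
apply: lte_scale; first exact: powR_ge0.
apply: (le_lt_trans (Lp_addD_le mIT p_gt0 m1 p1 mb (feedback_ge0 x))).
apply: lte_scale; first exact: powR_ge0.
apply: lte_add_pinfty; last first.
  have [C C0 HC] := feedback_bounded.
  by apply: (le_lt_trans (HC x mx)); exact: lte_scale C0 fin.
apply: (le_lt_trans (Lp_addD_le mIT p_gt0 mn0 n0 ms source_ge0)).
apply: lte_scale; first exact: powR_ge0.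
exact: lte_add_pinfty fin0 source_Lp.
Qed.

(** For x in L^p the integrability clauses of [Lp_solution] follow from [terms_integrable], so that
    solutions are the fixed points of the Picard map up to null sets. *)
Lemma solutionP x0 u x : admissible u ->
  Lp_solution T p alpha f g x0 u x <-> in_LpV T p x /\
    {ae mu, forall t, t \in `[0, T] -> x t = picard alpha f g x0 u x t}.
Proof.
move=> au; split=> [[Lx sol]|[Lx fix_]].
  by split => //; apply: filterS sol => t sol tT; have [] := sol tT.
split => //; apply: filterS2 (terms_integrable Lx au) fix_ => t int fix_ tT.
by have [] := int tT; split => //; exact: fix_.
Qed.

(* [c ^+ 4] is the constant of [picard_sub_le]. *)
Lemma gronwall_scalar : exists2 C : R, 0 <= C &
  forall (z : R -> R) (e : R -> \bar R),
  measurable_fun [set: R] z -> (forall t, 0 <= z t) ->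
  (forall t, t \notin `[0, T] -> z t = 0) ->
  measurable_fun `[0, T] e -> (forall t, (0 <= e t)%E) ->
  (\int[mu]_t (z t `^ p)%:E < +oo)%E ->
  {ae mu, forall t, t \in `[0, T] ->
    ((z t)%:E <= e t + (c ^+ 4)%:E * convolution k (Kr \* z)%R t)%E} ->
  (\int[mu]_t (z t `^ p)%:E <= C%:E * \int[mu]_(t in `[0%R, T]) (e t `^ p))%E.
Proof.
have c4 : 0 <= c ^+ 4 by rewrite exprn_ge0.
exact: (gronwall_Lp p_ge1 T_gt0 c4 mk k_ge0 mK Kr_ge0 Kr_smoothing).
Qed.

(** For differences of trajectories; [gronwall_scalar] remains necessary for sums of norms, which
    are not the norm of a trajectory. *)
Lemma gronwall_vector : exists2 C : R, 0 <= C &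
  forall (z : R -> 'rV[R]_n) (e : R -> \bar R),
  in_LpV T p z -> measurable_fun `[0, T] e -> (forall t, (0 <= e t)%E) ->
  {ae mu, forall t, t \in `[0, T] ->
    ((enorm (z t))%:E <= e t + (c ^+ 4)%:E * feedback z t)%E} ->
  (N z <= C%:E * \int[mu]_(t in `[0%R, T]) (e t `^ p))%E.
Proof.
have [C C0 HC] := gronwall_scalar.
exists C => // z e /(in_LpVP _ _ p_gt0)[mz fin] me e0 ineq.
rewrite -integralT_restr_enorm; apply: HC.
- exact: measurable_restr_enorm.
- exact: restr_enorm_ge0.
- exact: restr_enorm_out.
- exact: me.
- exact: e0.
- by rewrite integralT_restr_enorm; exact: fin.
by apply: filterS ineq => t ineq tT; rewrite (restr_enorm_in _ tT); exact: ineq.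
Qed.

Lemma stability : exists2 C : R, 0 <= C & forall x0 x0' u u' x x',
  in_LpV T p x0 -> in_LpV T p x0' -> admissible u -> admissible u' ->
  Lp_solution T p alpha f g x0 u x -> Lp_solution T p alpha f g x0' u' x' ->
  (N (fun t => x t - x' t)%R <= C%:E *
    (N (fun t => x0 t - x0' t)%R +
     \int[mu]_(t in `[0%R, T]) (control_gap_f x u u' t `^ p) +
     \int[mu]_(t in `[0%R, T]) (control_gap_g x u u' t `^ p)))%E.
Proof.
have [C C0 HC] := gronwall_vector.
have c4 : 0 <= c ^+ 4 by rewrite exprn_ge0.
have two : 1 <= 2 `^ p :> R by rewrite -{1}(powRr0 2) ler_powR ?ler1n// ltW.
(* The Gronwall constant, the constant of [picard_sub_le] raised to the power p, and one factor 2^p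
   for each of the two splittings of a sum of three terms. *)
exists (C * ((c ^+ 4) `^ p * (2 `^ p * 2 `^ p))).
  by rewrite !mulr_ge0 ?powR_ge0.
move=> x0 x0' u u' x x' L0 L0' au au' /(solutionP _ _ au)[Lx fx] /(solutionP _
  _ au')[Lx' fx'].
have [mx _] := Lx.
pose a t : \bar R := (enorm (x0 t - x0' t))%:E.
pose a1 := control_gap_f x u u'; pose a2 := control_gap_g x u u'.
have ma : measurable_fun `[0, T] a.
  by apply/measurable_EFinP; apply: measurable_fun_enorm;
    have [] := in_LpVB L0 L0'.
have a0 t : (0 <= a t)%E by rewrite lee_fin enorm_ge0.
have ma1 : measurable_fun `[0, T] a1 by exact: measurable_control_gap_f.
have ma2 : measurable_fun `[0, T] a2 by exact: measurable_control_gap_g.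
have a10 t : (0 <= a1 t)%E by exact: control_gap_f_ge0.
have a20 t : (0 <= a2 t)%E by exact: control_gap_g_ge0.
have maa1 : measurable_fun `[0, T] (fun t =>
  a t + a1 t)%E by exact: emeasurable_funD.
have maa2 : measurable_fun `[0, T] (fun t =>
  a t + a1 t + a2 t)%E by exact: emeasurable_funD.
have aa1 t : (0 <= a t + a1 t)%E by exact: adde_ge0.
have aa2 t : (0 <= a t + a1 t + a2 t)%E by exact: adde_ge0.
have := HC _ (fun t => (c ^+ 4)%:E * (a t + a1 t + a2 t))%E (in_LpVB Lx Lx').
move=> /(_ _ _ _)/le_trans; apply.
- exact: emeasurable_funM.
- by move=> t; rewrite mule_ge0 ?lee_fin.
- apply: filterS3 fx fx' (picard_sub_le x0 x0' Lx Lx' au au') => t fx fx' H tT.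
  rewrite (fx tT) (fx' tT); apply: (le_trans (H tT)).
  rewrite -ge0_muleDr; [|exact: aa2|exact: feedback_ge0]; apply: lee_wpmul2l;
    first by rewrite lee_fin.
  by rewrite (addeA (a t)) (addeA (a t)).
rewrite [in leRHS]EFinM -muleA; apply: lee_wpmul2l; first by rewrite lee_fin.
rewrite (Lp_scaleE p mIT c4 maa2 aa2) [in leRHS]EFinM -muleA;
  apply: lee_wpmul2l.
  by rewrite lee_fin powR_ge0.
apply: (le_trans (Lp_addD_le mIT p_gt0 maa1 aa1 ma2 a20)).
rewrite [in leRHS]EFinM -muleA; apply: lee_wpmul2l;
  first by rewrite lee_fin powR_ge0.
have I0 e : (0 <= \int[mu]_(t in `[0%R, T]) (e t `^ p))%E.
  by apply: integral_ge0 => t _; exact: poweR_ge0.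
rewrite [leRHS]ge0_muleDr; [|by apply: adde_ge0;
  [exact: (I0 a)|exact: (I0 a1)]|exact: I0].
apply: leeD; first exact: (Lp_addD_le mIT p_gt0 ma a0 ma1 a10).
by rewrite -[leLHS]mul1e; apply: lee_wpmul2r; [exact: I0|rewrite lee_fin].
Qed.

Lemma a_priori : exists2 C : R, 0 <= C & forall x0 u x,
  in_LpV T p x0 -> admissible u -> Lp_solution T p alpha f g x0 u x ->
  (N x <= C%:E * (1 + N x0))%E.
Proof.
have [C C0 HC] := gronwall_vector.
have c4 : 0 <= c ^+ 4 by rewrite exprn_ge0.
set S := (\int[mu]_(t in `[0%R, T]) (source t `^ p))%E.
have S0 : (0 <= S)%E by apply: integral_ge0 => t _; exact: poweR_ge0.
have Sfin : S \is a fin_num by rewrite ge0_fin_numE//; exact: source_Lp.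
have s0 : 0 <= fine S by exact: fine_ge0.
(* With S the integral of the p-th power of [source], the factor 1 + S serves in N x0 + S <= (1 + S)
   (1 + N x0). *)
exists (C * ((c ^+ 4) `^ p * (2 `^ p * (1 + fine S)))).
  by rewrite !mulr_ge0 ?powR_ge0 ?addr_ge0.
move=> x0 u x [mx0 _] au /(solutionP _ _ au)[Lx fx].
have [mx _] := Lx.
pose a t : \bar R := (enorm (x0 t))%:E.
have ma : measurable_fun `[0, T] a.
  by apply/measurable_EFinP; exact: measurable_fun_enorm.
have a0 t : (0 <= a t)%E by rewrite lee_fin enorm_ge0.
have ms : measurable_fun `[0,
  T] source by exact: measurable_funTS measurable_source.
have mas : measurable_fun `[0, T] (fun t =>
  a t + source t)%E by exact: emeasurable_funD.
have as0 t : (0 <= a t + source t)%E by rewrite adde_ge0 ?source_ge0.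
have := HC x (fun t => (c ^+ 4)%:E * (a t + source t))%E Lx.
move=> /(_ _ _ _)/le_trans; apply.
- exact: emeasurable_funM.
- by move=> t; rewrite mule_ge0 ?lee_fin.
- apply: filterS fx => t fx tT; rewrite (fx tT).
  rewrite -ge0_muleDr; [exact: picard_le|exact: as0|exact: feedback_ge0].
rewrite [in leRHS]EFinM -muleA; apply: lee_wpmul2l; first by rewrite lee_fin.
rewrite (Lp_scaleE p mIT c4 mas as0) [in leRHS]EFinM -muleA; apply: lee_wpmul2l.
  by rewrite lee_fin powR_ge0.
apply: (le_trans (Lp_addD_le mIT p_gt0 ma a0 ms source_ge0)).
rewrite [in leRHS]EFinM -muleA; apply: lee_wpmul2l;
  first by rewrite lee_fin powR_ge0.
have N0 : (0 <= N x0)%E by apply: integral_ge0 => t _; rewrite lee_fin powR_ge0.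
have s1 : (0 <= (1 + fine S)%:E)%E by rewrite lee_fin addr_ge0.
rewrite -/S -(fineK Sfin) [leRHS]ge0_muleDr; [|exact: lee01|exact: N0].
rewrite mule1 addeC; apply: leeD.
  by rewrite lee_fin lerDr.
by rewrite -[leLHS]mul1e; apply: lee_wpmul2r; [exact: N0|rewrite lee_fin lerDl].
Qed.

Lemma integral_enorm_le0_ae (z : R -> 'rV[R]_n) :
  measurable_fun `[0, T] z -> (N z <= 0)%E ->
  {ae mu, forall t, t \in `[0, T] -> z t = 0}.
Proof.
move=> mz Nle0.
have mE : measurable_fun `[0, T] (fun t => (enorm (z t) `^ p)%:E).
  apply/measurable_EFinP; apply: (measurableT_comp (measurable_powR _)).
  exact: measurable_fun_enorm.
have : (\int[mu]_(t in `[0%R, T]) `|(enorm (z t) `^ p)%:E| = 0)%E.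
  apply/eqP; rewrite eq_le; apply/andP; split; last by apply: integral_ge0.
  apply: le_trans Nle0; rewrite le_eqVlt; apply/orP; left; apply/eqP.
  by apply: eq_integral => t _; rewrite gee0_abs// lee_fin powR_ge0.
move=> /(ae_eq_integral_abs mu mIT mE).
apply: filterS => t H tT; apply: enorm_eq0; have [] := H tT.
by move=> /powR_eq0_eq0.
Qed.

Lemma uniqueness x0 u x y : in_LpV T p x0 -> admissible u ->
  Lp_solution T p alpha f g x0 u x -> Lp_solution T p alpha f g x0 u y ->
  {ae mu, forall t, t \in `[0, T] -> y t = x t}.
Proof.
move=> L0 au sx sy.
have [C C0 HC] := stability.
have := HC x0 x0 u u y x L0 L0 au au sy sx.
set Nyx := (X in (X <= _)%E).
have -> : N (fun t => x0 t - x0 t) = 0%E.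
  by apply: integral0_eq => t _; rewrite subrr enorm0 powR0// gt_eqF.
have -> : (\int[mu]_(t in `[0%R, T]) control_gap_f y u u t `^ p)%E = 0%E.
  by apply: integral0_eq => t _; rewrite control_gap_f_refl poweR0r// gt_eqF.
have -> : (\int[mu]_(t in `[0%R, T]) control_gap_g y u u t `^ p)%E = 0%E.
  by apply: integral0_eq => t _; rewrite control_gap_g_refl poweR0r// gt_eqF.
rewrite !adde0 mule0 => Nle0.
have [mD _] := in_LpVB sy.1 sx.1.
apply: filterS (integral_enorm_le0_ae mD Nle0) => t H tT.
by apply/eqP; rewrite -subr_eq0; apply/eqP; exact: H.
Qed.

Lemma convolution_feedback_sum (y : nat -> R -> 'rV[R]_n) m t :
  (forall j, measurable_fun `[0, T] (y j)) ->
  convolution k (Kr \* (fun s => \sum_(j < m) restr_enorm T (y j) s))%R t =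
  (\sum_(j < m) feedback (y j) t)%E.
Proof.
move=> my; elim: m => [|m IHm].
  rewrite big_ord0 /convolution integral0_eq// => s _.
  by rewrite /= big_ord0 mulr0 mulr0.
rewrite big_ord_recr/= -IHm /feedback -convolutionD//.
- by congr (convolution _ _ _); apply/funext => s /=;
  rewrite big_ord_recr/= mulrDr.
- apply: measurable_funM => //; apply: measurable_sum => j.
  exact: measurable_restr_enorm.
- by move=> s; rewrite mulr_ge0// sumr_ge0// => j _; exact: restr_enorm_ge0.
- by apply: measurable_funM => //; exact: measurable_restr_enorm.
- by move=> s; rewrite mulr_ge0 ?restr_enorm_ge0.
Qed.

(** * The Picard iteration and the sums of its increments *)

Section picard_iteration.
Variables (x0 : R -> 'rV[R]_n) (u : R -> 'rV[R]_d).
Hypotheses (Lx0 : in_LpV T p x0) (au : admissible u).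
Local Notation Phi := (picard alpha f g x0 u).

(** Starting from 0 makes each iterate the sum of the preceding increments, and lets the error
    estimate at j = 0 bound the limit itself. *)
Definition iterate (j : nat) : R -> 'rV[R]_n := iter j Phi (fun=> 0).
Definition increment (j : nat) (t : R) :
  'rV[R]_n := iterate j.+1 t - iterate j t.
Definition increments (m : nat) (t : R) :
  R := \sum_(j < m) restr_enorm T (increment j) t.

Lemma in_LpV_iterate j : in_LpV T p (iterate j).
Proof.
elim: j => [|j IHj]; last exact: in_LpV_picard.
apply/(in_LpVP _ _ p_gt0); split; first exact: measurable_cst.
rewrite integral0_eq// => t _.
by rewrite /iterate /= enorm0 powR0// gt_eqF.
Qed.

Lemma in_LpV_increment j : in_LpV T p (increment j).
Proof. by apply: in_LpVB; exact: in_LpV_iterate. Qed.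

Lemma measurable_increment j : measurable_fun `[0, T] (increment j).
Proof. by have [] := in_LpV_increment j. Qed.

Lemma measurable_increments m : measurable_fun [set: R] (increments m).
Proof.
by apply: measurable_sum => j; apply: measurable_restr_enorm;
  exact: measurable_increment.
Qed.

Lemma increments_ge0 m t : 0 <= increments m t.
Proof. by apply: sumr_ge0 => j _; exact: restr_enorm_ge0. Qed.

Lemma increments_nd t : nondecreasing_seq (increments ^~ t).
Proof.
apply/nondecreasing_seqP => m; rewrite /increments big_ord_recr/= lerDl.
exact: restr_enorm_ge0.
Qed.

(** A bound depending on m, whose only purpose is to meet the finiteness hypothesis of the Gronwall
    inequality; uniformity comes from [increments_bounded]. *)
Lemma increments_fin m : (\int[mu]_t (increments m t `^ p)%:E < +oo)%E.
Proof.
elim: m => [|m IHm].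
  by rewrite integral0_eq// => t _; rewrite /increments big_ord0 powR0// gt_eqF.
have m1 : measurable_fun [set: R] (fun t => (increments m t)%:E).
  apply/measurable_EFinP; exact: measurable_increments.
have m2 : measurable_fun [set: R] (fun t => (restr_enorm T (increment m) t)%:E).
  apply/measurable_EFinP; apply: measurable_restr_enorm;
    exact: measurable_increment.
have p1 t : (0 <= (increments m t)%:E)%E by rewrite lee_fin increments_ge0.
have p2 t : (0 <= (restr_enorm T (increment m) t)%:E)%E by rewrite lee_fin
  restr_enorm_ge0.
have -> : (\int[mu]_t (increments m.+1 t `^ p)%:E =
    \int[mu]_t (((increments m t)%:E + (restr_enorm T (increment m) t)%:E) `^
      p))%E.
  by apply: eq_integral => t _; rewrite /increments big_ord_recr.
apply: (le_lt_trans (Lp_addD_le measurableT p_gt0 m1 p1 m2 p2)).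
apply: lte_scale; first exact: powR_ge0.
apply: lte_add_pinfty; first exact: IHm.
have /(in_LpVP _ _ p_gt0)[_ fin] := in_LpV_increment m.
have -> : (\int[mu]_t (restr_enorm T (increment m) t)%:E `^ p = N (increment
  m))%E.
  exact: integralT_restr_enorm.
exact: fin.
Qed.

Lemma increment_le j : {ae mu, forall t, t \in `[0, T] ->
  ((restr_enorm T (increment j.+1) t)%:E <= (c ^+ 4)%:E * feedback (increment
    j) t)%E}.
Proof.
apply: filterS (picard_sub_le x0 x0 (in_LpV_iterate j.+1) (in_LpV_iterate j) au
  au).
move=> t H tT; rewrite (restr_enorm_in _ tT); apply: (le_trans (H tT)).
by rewrite subrr enorm0 control_gap_f_refl control_gap_g_refl !add0e.
Qed.

(** Write D_m for the partial sums, y_j for the increments and A for the convolution operator.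
    Summing [increment_le] gives D_(m+1) <= |y_0| + c^4 A D_m <= |y_0| + c^4 A D_(m+1), and the
    Gronwall inequality bounds D_(m+1) by |y_0| alone. *)
Lemma increments_bounded : exists2 B : R, 0 <= B &
  forall m, (\int[mu]_t (increments m t `^ p)%:E <= B%:E)%E.
Proof.
have [C C0 HC] := gronwall_scalar.
have /(in_LpVP _ _ p_gt0)[_ fin0] := in_LpV_increment 0.
pose e t : \bar R := (restr_enorm T (increment 0) t)%:E.
have eE : (\int[mu]_(t in `[0%R, T]) (e t `^ p) = N (increment 0))%E.
  exact: integral_restr_enorm.
have N0 : (0 <= N (increment 0))%E.
  by apply: integral_ge0 => t _; rewrite lee_fin powR_ge0.
have Nfin : N (increment 0) \is a fin_num by rewrite ge0_fin_numE//;
  exact: fin0.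
have c4 : 0 <= c ^+ 4 by rewrite exprn_ge0.
exists (C * fine (N (increment 0))); first by rewrite mulr_ge0// fine_ge0.
move=> m; rewrite EFinM (fineK Nfin) -eE.
apply: (@le_trans _ _ (\int[mu]_t (increments m.+1 t `^ p)%:E)%E).
  apply: ge0_le_integral; [exact: measurableT| | | |].
  - by move=> t _; rewrite lee_fin powR_ge0.
  - apply/measurable_EFinP; apply: (measurableT_comp (measurable_powR _)).
    exact: measurable_increments.
  - apply/measurable_EFinP; apply: (measurableT_comp (measurable_powR _)).
    exact: measurable_increments.
  move=> t _; rewrite lee_fin ge0_ler_powR ?nnegrE ?increments_ge0 ?(ltW
    p_gt0)//.
  exact: increments_nd.
apply: HC.
- exact: measurable_increments.
- exact: increments_ge0.
- by move=> t tT; apply: big1 => j _; exact: restr_enorm_out.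
- apply/measurable_EFinP; apply: measurable_funTS;
  apply: measurable_restr_enorm.
  exact: measurable_increment.
- by move=> t; rewrite lee_fin restr_enorm_ge0.
- exact: increments_fin.
have := ae_foralln increment_le.
apply: filterS => t H tT.
rewrite {1}/increments big_ord_recl EFinD; apply: leeD; first exact: lexx.
apply: (@le_trans _ _ (\sum_(j < m) (c ^+ 4)%:E * feedback (increment j) t)%E).
  by rewrite -sumEFin; apply: lee_sum => j _; exact: (H j tT).
rewrite -ge0_sume_distrr; last by move=> j _; exact: feedback_ge0.
apply: lee_wpmul2l; first by rewrite lee_fin.
rewrite -convolution_feedback_sum; last exact: measurable_increment.
have mD j : measurable_fun [set: R] (fun s =>
  k (t - s) * (Kr \* increments j)%R s).
  apply: measurable_funM; first exact: measurable_fun_shift.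
  by apply: measurable_funM => //; exact: measurable_increments.
(* D_m is enlarged to D_(m+1), so that the same function stands on both sides. *)
apply: ge0_le_integral; [exact: measurableT| | | |].
- by move=> s _; rewrite lee_fin !mulr_ge0// increments_ge0.
- by apply/measurable_EFinP; exact: mD.
- by apply/measurable_EFinP; exact: mD.
move=> s _; rewrite lee_fin; apply: ler_wpM2l; first exact: k_ge0.
apply: ler_wpM2l; first exact: Kr_ge0.
exact: (increments_nd s (leqnSn m)).
Qed.

Lemma ler_sub_iterate (t : R) i j l : t \in `[0, T] ->
  `|iterate j t ord0 i - iterate l t ord0 i| <= increments (maxn j l) t.
Proof.
move=> tT; wlog lj : j l / (l <= j)%N.
  move=> H; case/orP: (leq_total l j) => [lj|jl]; first exact: H.
  by rewrite distrC maxnC; exact: H.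
rewrite (maxn_idPl lj).
rewrite -(telescope_sumr (fun j => iterate j t ord0 i) lj).
apply: (le_trans (ler_norm_sum _ _ _)).
rewrite /increments -(big_mkord xpredT (fun j =>
  restr_enorm T (increment j) t)).
rewrite (big_cat_nat (leq0n l) lj)/= ler_wpDl//.
  by apply: sumr_ge0 => ? _; exact: restr_enorm_ge0.
apply: ler_sum => q _; rewrite (restr_enorm_in _ tT).
by apply: le_trans (ler_coord_enorm _ i); rewrite /increment !mxE.
Qed.

Lemma iterate_cvg (t G : R) i :
  t \in `[0, T] -> (forall m, increments m t <= G) ->
  cvgn (fun j => iterate j t ord0 i).
Proof.
move=> tT HG.
pose a j := iterate j t ord0 i.
have -> : (fun j => iterate j t ord0 i) = series (telescope a).
  apply/funext => j; rewrite telescopeK /= /a.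
  by rewrite {2}/iterate /= mxE subr0.
apply: normed_cvg; apply: nondecreasing_is_cvgn.
  apply/nondecreasing_seqP => j; rewrite -subr_ge0 seriesSB; exact: normr_ge0.
exists G => _ [j _ <-]; apply: le_trans (HG j).
rewrite -[leLHS]/(series (fun q => `|telescope a q|) j) seriesEord /=;
  apply: ler_sum => q _; rewrite (restr_enorm_in _ tT).
by apply: le_trans (ler_coord_enorm _ i);
  rewrite /increment mxE [X in _ + X]mxE.
Qed.

(** An upper limit exists at every t and is measurable; it agrees with the limit wherever the
    iterates converge. *)
Definition picard_limit (t : R) : 'rV[R]_n :=
  \row_i fine (limn_esup (fun j => (iterate j t ord0 i)%:E)).

Lemma measurable_picard_limit : measurable_fun `[0, T] picard_limit.
Proof.
apply/measurable_fun_rVP; first exact: mIT.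
move=> i.
rewrite (_ : (fun _ => _) =
    fun t => fine (limn_esup (fun j => (iterate j t ord0 i)%:E))); last first.
  by apply/funext => t; rewrite mxE.
apply: (measurableT_comp (@fine_measurable R setT measurableT)).
apply: measurable_fun_limn_esup => j; apply/measurable_EFinP.
have [mx _] := in_LpV_iterate j.
by move: i; apply/measurable_fun_rVP; first exact: mIT.
Qed.

Lemma iterate_cvg_limit (t G : R) i : t \in `[0, T] ->
  (forall m, increments m t <= G) ->
  iterate j t ord0 i @[j --> \oo] --> picard_limit t ord0 i.
Proof.
move=> tT HG; have cv := @iterate_cvg t G i tT HG.
have cvE : ((iterate j t ord0 i)%:E @[j --> \oo] -->
    (limn (fun j => iterate j t ord0 i))%R%:E)%E.
  by apply: cvg_EFin; [exact: nearW|exact: cv].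
rewrite mxE is_cvg_limn_esupE; last by apply/cvg_ex; eexists; exact: cvE.
by rewrite (cvg_lim _ cvE).
Qed.

Lemma iterate_limit_le (t G : R) j : t \in `[0, T] ->
  (forall m, increments m t <= G) ->
  enorm (iterate j t - picard_limit t) <= c * G.
Proof.
move=> tT HG.
have G0 : 0 <= G by apply: le_trans (HG 0%N); exact: increments_ge0.
apply: enorm_le_coord => // i; rewrite mxE [X in _ + X]mxE.
have cv := @iterate_cvg_limit t G i tT HG.
have cvn : `|iterate j t ord0 i - iterate l t ord0 i| @[l --> \oo] -->
    `|iterate j t ord0 i - picard_limit t ord0 i|.
  by apply: cvg_norm; apply: cvgB => //; exact: cvg_cst.
rewrite -(cvg_lim _ cvn)//; apply: limr_le.
  by apply/cvg_ex; eexists; exact: cvn.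
by apply: nearW => l; exact: le_trans (ler_sub_iterate i j l tT) (HG _).
Qed.

End picard_iteration.

Lemma enorm_powR_cvg0 (v : nat -> 'rV[R]_n) :
  (forall i, v j ord0 i @[j --> \oo] --> 0) ->
  (enorm (v j) `^ p)%:E @[j --> \oo] --> 0%E.
Proof.
move=> v0; apply: cvg_EFin; first exact: nearW.
apply/cvgrPdist_le => e e0; rewrite /comp /=.
(* Coordinates at most [e'] give a norm at most c e', whose p-th power is e. *)
pose e' := e `^ p^-1 / c.
have e'0 : 0 < e' by rewrite divr_gt0 ?powR_gt0.
have : \forall j \near \oo, forall i, `|v j ord0 i| <= e'.
  apply: filter_forall => i.
  have /cvgrPdist_le/(_ e' e'0) := v0 i.
  by apply: filterS => j; rewrite sub0r normrN.
apply: filterS => j vj; rewrite sub0r normrN ger0_norm ?powR_ge0//.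
have -> : e = (e `^ p^-1) `^ p.
  by rewrite -powRrM mulVf ?gt_eqF// powRr1// ltW.
rewrite ge0_ler_powR ?nnegrE ?enorm_ge0 ?powR_ge0 ?(ltW p_gt0)//.
have -> : e `^ p^-1 = c * e' by rewrite /e' mulrC divfK.
by apply: enorm_le_coord => //; exact: ltW.
Qed.

(** * Convergence of the iteration to a solution *)

Section picard_existence.
Variables (x0 : R -> 'rV[R]_n) (u : R -> 'rV[R]_d).
Hypotheses (Lx0 : in_LpV T p x0) (au : admissible u).
Local Notation Phi := (picard alpha f g x0 u).
Local Notation xs := (iterate x0 u).
Local Notation x := (picard_limit x0 u).
Local Notation D := (increments x0 u).

(** Increasing limit of the p-th powers of the partial sums, possibly infinite. Its integral is
    finite by monotone convergence; it therefore yields a pointwise bound almost everywhere and,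
    times c^p, the majorant for dominated convergence. *)
Let S (t : R) : \bar R := limn (fun m => (D m t `^ p)%:E).

Let D_pow_nd t : nondecreasing_seq (fun m => (D m t `^ p)%:E).
Proof.
move=> m m' mm'; rewrite lee_fin ge0_ler_powR ?nnegrE ?increments_ge0 ?(ltW
  p_gt0)//.
exact: increments_nd.
Qed.

Let mDp m : measurable_fun [set: R] (fun t => (D m t `^ p)%:E).
Proof.
apply/measurable_EFinP; apply: (measurableT_comp (measurable_powR _)).
exact: measurable_increments.
Qed.

Let le_S t m : ((D m t `^ p)%:E <= S t)%E.
Proof.
rewrite /S (cvg_lim _ (ereal_nondecreasing_cvgn (@D_pow_nd t)))//.
by apply: ereal_sup_ubound; exists m.
Qed.

Let S_ge0 t : (0 <= S t)%E.
Proof. by apply: le_trans (le_S t 0%N); rewrite lee_fin powR_ge0. Qed.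

Let mS : measurable_fun [set: R] S.
Proof.
apply: (emeasurable_fun_cvg (fun m t => (D m t `^ p)%:E)); first exact: mDp.
by move=> t _; exact: ereal_nondecreasing_is_cvgn (@D_pow_nd t).
Qed.

Let S_fin : (\int[mu]_t S t < +oo)%E.
Proof.
have [B B0 HB] := increments_bounded Lx0 au.
apply: (@le_lt_trans _ _ B%:E); last exact: ltry.
have nd m m' : (m <= m')%N -> (\int[mu]_t (D m t `^ p)%:E <= \int[mu]_t (D m' t
  `^ p)%:E)%E.
  move=> mm'; apply: ge0_le_integral;
    [exact: measurableT| | exact: mDp|exact: mDp|].
    by move=> t _; rewrite lee_fin powR_ge0.
  by move=> t _; exact: D_pow_nd.
rewrite /S monotone_convergence.
- apply: lime_le; first exact: ereal_nondecreasing_is_cvgn nd.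
  by apply: nearW => m; exact: HB.
- exact: measurableT.
- exact: mDp.
- by move=> m t _; rewrite lee_fin powR_ge0.
- by move=> t _; exact: D_pow_nd.
Qed.

Let bound (t : R) : R := fine (S t) `^ p^-1.

Let increments_le_bound t m : (S t < +oo)%E -> D m t <= bound t.
Proof.
move=> Sfin.
have Sfn : S t \is a fin_num by rewrite ge0_fin_numE.
have := le_S t m; rewrite -{1}(fineK Sfn) lee_fin => DS.
have -> : D m t = (D m t `^ p) `^ p^-1.
  by rewrite -powRrM mulfV ?gt_eqF// powRr1// increments_ge0.
by rewrite /bound ge0_ler_powR ?nnegrE ?invr_ge0 ?powR_ge0 ?fine_ge0// ltW.
Qed.

Let S_ae : {ae mu, forall t, `[0, T]%classic t -> (S t < +oo)%E}.
Proof.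
have fin1 : (\int[mu]_t (S t `^ 1) < +oo)%E.
  rewrite (_ : (\int[mu]_t _)%E = (\int[mu]_t S t)%E); first exact: S_fin.
  by apply: eq_integral => t _; rewrite poweRe1.
have := ae_lty measurableT ltr01 mS S_ge0 fin1.
by apply: filterS => t H _; exact: (H I).
Qed.

Let mx : measurable_fun `[0, T] x.
Proof. exact: measurable_picard_limit. Qed.

Let residual_le t j : t \in `[0, T] -> (S t < +oo)%E ->
  ((enorm (xs j t - x t) `^ p)%:E <= (c `^ p)%:E * S t)%E.
Proof.
move=> tT Sfin; have Sfn : S t \is a fin_num by rewrite ge0_fin_numE.
rewrite -(fineK Sfn) -EFinM lee_fin.
have -> : fine (S t) = bound t `^ p.
  by rewrite /bound -powRrM mulVf ?gt_eqF// powRr1// fine_ge0.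
rewrite -powRM ?powR_ge0// ge0_ler_powR ?nnegrE ?enorm_ge0 ?mulr_ge0 ?powR_ge0
  ?(ltW p_gt0)//.
by apply: iterate_limit_le => // m; exact: increments_le_bound.
Qed.

Let iS : mu.-integrable IT (fun t => ((c `^ p)%:E * S t)%E).
Proof.
apply/integrableP; split.
  by apply: emeasurable_funM => //; exact: measurable_funTS mS.
apply: (@le_lt_trans _ _ ((c `^ p)%:E * \int[mu]_t S t)%E); last first.
  exact: lte_scale (powR_ge0 _ _) S_fin.
rewrite -ge0_integralZl_EFin ?powR_ge0//.
rewrite [leLHS](_ : _ = (\int[mu]_(t in IT) ((c `^ p)%:E * S t))%E); last first.
  by apply: eq_integral => t _; rewrite gee0_abs// mule_ge0// lee_fin powR_ge0.
apply: ge0_subset_integral.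
- exact: mIT.
- exact: measurableT.
- exact: emeasurable_funM.
- by move=> t _; rewrite mule_ge0// lee_fin powR_ge0.
- by [].
Qed.

Let mres j : measurable_fun `[0, T] (fun t => (enorm (xs j t - x t) `^ p)%:E).
Proof.
apply/measurable_EFinP; apply: (measurableT_comp (measurable_powR _)).
apply: measurable_fun_enorm; apply: measurable_fun_rVB => //.
by have [] := in_LpV_iterate Lx0 au j.
Qed.

Let Lx : in_LpV T p x.
Proof.
apply/(in_LpVP _ _ p_gt0); split; first exact: mx.
apply: (@le_lt_trans _ _ (\int[mu]_(t in IT) ((c `^ p)%:E * S t))%E).
  apply: ae_le_integral.
  - exact: mIT.
  - by move=> t _; rewrite lee_fin powR_ge0.
  - apply/measurable_EFinP; apply: (measurableT_comp (measurable_powR _)).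
    exact: measurable_fun_enorm mx.
  - by move=> t _; rewrite mule_ge0// lee_fin powR_ge0.
  - by apply: emeasurable_funM => //; exact: measurable_funTS mS.
  apply: filterS S_ae => t H tT.
  (* The iterate of index 0 vanishes, so this residual is the limit up to sign. *)
  have := residual_le 0 tT (H tT).
  by rewrite /iterate /= sub0r enormN.
exact: integrable_lty iS.
Qed.

Let residual_cvg0 : (N (fun t => xs j t - x t)%R) @[j --> \oo] --> 0%E.
Proof.
pose f_ j t := (enorm (xs j t - x t) `^ p)%:E.
have cvgf : {ae mu, forall t, IT t -> f_ j t @[j --> \oo] --> 0%E}.
  apply: filterS S_ae => t H tT; apply: enorm_powR_cvg0 => i.
  have Hb m := increments_le_bound m (H tT).
  have cv := iterate_cvg_limit (i := i) tT Hb.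
  rewrite (_ : (fun j => _) = fun j => xs j t ord0 i - x t ord0 i).
    by rewrite -(subrr (x t ord0 i)); apply: cvgB => //; exact: cvg_cst.
  by apply/funext => j; rewrite mxE [X in _ + X]mxE.
have bndf : {ae mu, forall t j, IT t -> (`|f_ j t| <= (c `^ p)%:E * S t)%E}.
  apply: filterS S_ae => t H j tT.
  by rewrite gee0_abs ?lee_fin ?powR_ge0//; exact: residual_le (H tT).
have [_ _] := @dominated_convergence _ _ _ mu IT mIT f_ (fun=> 0%E)
  (fun t => ((c `^ p)%:E * S t)%E) mres (measurable_cst _) cvgf iS bndf.
by rewrite integral0.
Qed.

(** Write x - Phi x = (Phi x_j - Phi x) - (x_(j+1) - x), since x_(j+1) = Phi x_j. The p-th power
    integral of the left side does not depend on j, while it is bounded by a multiple of the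
    residuals at j and j + 1, which tend to 0. *)
Lemma picard_limit_solution : Lp_solution T p alpha f g x0 u x.
Proof.
apply/(solutionP _ _ au); split; first exact: Lx.
have LP := in_LpV_picard Lx0 Lx au.
have [C C0 HC] := feedback_bounded.
have c4 : 0 <= c ^+ 4 by rewrite exprn_ge0.
have c0 : 0 <= c by [].
(* In [M1], c comes from [enormB_le] and 2^p from splitting the sum; in [M2], c^4 comes from
   [picard_sub_le] and C from the boundedness of [feedback]. *)
pose M1 := c `^ p * 2 `^ p; pose M2 := (c ^+ 4) `^ p * C.
have M10 : 0 <= M1 by rewrite mulr_ge0 ?powR_ge0.
have M20 : 0 <= M2 by rewrite mulr_ge0 ?powR_ge0.
have [mdx _] := in_LpVB Lx LP.
have main j : (N (fun t => x t - Phi x t)%R <= M1%:E *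
    (N (fun t => xs j.+1 t - x t)%R + M2%:E * N (fun t => xs j t - x t)%R))%E.
  have Lj := in_LpV_iterate Lx0 au j.
  have [mj1 _] := in_LpVB (in_LpV_iterate Lx0 au j.+1) Lx.
  have [mj _] := in_LpVB Lj Lx.
  pose a t : \bar R := (enorm (xs j.+1 t - x t))%:E.
  pose b t : \bar R := feedback (fun s => xs j s - x s)%R t.
  have ma : measurable_fun `[0, T] a.
    by apply/measurable_EFinP; exact: measurable_fun_enorm mj1.
  have a0 t : (0 <= a t)%E by rewrite lee_fin enorm_ge0.
  have mb : measurable_fun `[0, T] b.
    exact: measurable_funTS (measurable_feedback mj).
  have b0 t : (0 <= b t)%E by exact: feedback_ge0.
  have mcb : measurable_fun `[0, T] (fun t => (c ^+ 4)%:E * b t)%E.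
    exact: emeasurable_funM.
  have cb0 t : (0 <= (c ^+ 4)%:E * b t)%E by rewrite mule_ge0 ?lee_fin.
  have mab : measurable_fun `[0, T] (fun t => a t + (c ^+ 4)%:E * b t)%E.
    exact: emeasurable_funD.
  have ab0 t : (0 <= a t + (c ^+ 4)%:E * b t)%E by exact: adde_ge0.
  apply: (@le_trans _ _ (\int[mu]_(t in `[0%R, T])
      ((c%:E * (a t + (c ^+ 4)%:E * b t)) `^ p))%E).
    rewrite integral_enorm_poweR; apply: (Lp_le mIT p_gt0).
    - by apply/measurable_EFinP; exact: measurable_fun_enorm mdx.
    - by move=> t; rewrite lee_fin enorm_ge0.
    - exact: emeasurable_funM.
    - by move=> t; apply: mule_ge0; [rewrite lee_fin|exact: ab0].
    apply: filterS (picard_sub_le x0 x0 Lj Lx au au) => t H tT.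
    have {H} := H tT.
    rewrite subrr enorm0 control_gap_f_refl control_gap_g_refl !add0e => H.
    apply: (@le_trans _ _ (c%:E * (a t + (enorm (xs j.+1 t - Phi x t))%:E))%E).
      rewrite -EFinD -EFinM lee_fin.
      have -> : x t - Phi x t = (xs j.+1 t - Phi x t) - (xs j.+1 t - x t).
        by rewrite opprB [RHS]addrC addrA subrK.
      by rewrite (addrC (enorm (xs j.+1 t - x t))); exact: enormB_le.
    by apply: lee_wpmul2l; [rewrite lee_fin|exact: leeD (lexx _) H].
  have -> : M1%:E = ((c `^ p)%:E * (2 `^ p)%:E)%E by rewrite -EFinM.
  rewrite (Lp_scaleE p mIT c0 mab ab0) -[leRHS]muleA.
  apply: lee_wpmul2l; first by rewrite lee_fin powR_ge0.
  apply: (le_trans (Lp_addD_le mIT p_gt0 ma a0 mcb cb0)).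
  apply: lee_wpmul2l; first by rewrite lee_fin powR_ge0.
  apply: leeD; first exact: lexx.
  have -> : M2%:E = (((c ^+ 4) `^ p)%:E * C%:E)%E by rewrite -EFinM.
  rewrite (Lp_scaleE p mIT c4 mb b0) -[leRHS]muleA.
  apply: lee_wpmul2l; first by rewrite lee_fin powR_ge0.
  exact: HC mj.
have N0 : (N (fun t => x t - Phi x t)%R <= 0)%E.
  apply/lee_addgt0Pr => e e0; rewrite add0e.
  (* Residuals at most e / M give the total M1 (1 + M2) e / M <= e; the added 1 makes the division
     legitimate. *)
  pose M := M1 * (1 + M2) + 1.
  have M0 : 0 < M by rewrite ltr_wpDl// mulr_ge0// addr_ge0.
  have d0 : 0 < e / M by rewrite divr_gt0.
  move/fine_cvgP : residual_cvg0 => [fin /cvgrPdist_le/(_ _ d0)[m _ Hm]].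
  case: fin => m' _ Hm'.
  have small j : (m <= j)%N -> (m' <= j)%N ->
      (N (fun t => xs j t - x t)%R <= (e / M)%:E)%E.
    move=> mj m'j; have fj := Hm' j m'j.
    rewrite -(fineK fj) lee_fin; apply: le_trans (Hm j mj).
    by rewrite sub0r normrN ler_norm.
  pose j := maxn m m'.
  have s1 := small j (leq_maxl _ _) (leq_maxr _ _).
  have s2 := small j.+1 (leqW (leq_maxl _ _)) (leqW (leq_maxr _ _)).
  apply: (le_trans (main j)).
  apply: (@le_trans _ _ (M1%:E * ((e / M)%:E + M2%:E * (e / M)%:E))%E).
    apply: lee_wpmul2l; first by rewrite lee_fin.
    by apply: leeD; [exact: s2|apply: lee_wpmul2l; [rewrite lee_fin|exact: s1]].
  rewrite [leLHS](_ : _ = (M1 * (e / M + M2 * (e / M)))%:E)// lee_fin.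
  have -> : M1 * (e / M + M2 * (e / M)) = (M1 * (1 + M2)) * (e / M) by ring.
  apply: (@le_trans _ _ (M * (e / M))).
    by apply: ler_wpM2r; [exact: ltW|rewrite /M lerDl].
  by rewrite mulrC divfK// gt_eqF.
apply: filterS (integral_enorm_le0_ae mdx N0) => t H tT.
by apply/eqP; rewrite -subr_eq0; apply/eqP; exact: H.
Qed.

End picard_existence.

(** The estimates of p-th powers are raised to the power 1/p: the constants become C^(1/p), with a
    factor 2^(1/p) for each splitting of a sum under the root. *)
Lemma well_posedness :
  [/\ forall x0 u, in_LpV T p x0 -> admissible_control U u0 T p u ->
        exists2 x, Lp_solution T p alpha f g x0 u x &
          forall y, Lp_solution T p alpha f g x0 u y ->
            {ae @lebesgue_measure R, forall t : R, t \in `[0, T] -> y t = x t},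
      exists2 C : R, 0 <= C &
        forall x0 u x, in_LpV T p x0 -> admissible_control U u0 T p u ->
          Lp_solution T p alpha f g x0 u x ->
          (LpV_norm T p x <= C%:E * (1 + LpV_norm T p x0 +
             Lp_norm T p%:E (fun t => enorm (u t - u0)%R)))%E &
      exists2 C : R, 0 <= C &
        forall x0 x0' u u' x x',
          in_LpV T p x0 -> in_LpV T p x0' ->
          admissible_control U u0 T p u -> admissible_control U u0 T p u' ->
          Lp_solution T p alpha f g x0 u x ->
          Lp_solution T p alpha f g x0' u' x' ->
          (LpV_norm T p (fun t => x t - x' t)%R
           <= C%:E * LpV_norm T p (fun t => x0 t - x0' t)%R
            + C%:E * (\int[@lebesgue_measure R]_(t in `[0%R, T])
                (\int[@lebesgue_measure R]_(s in `[0%R, t])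
                  (enorm (f t s (x s) (u s) - f t s (x s) (u' s))
                   / (t - s) `^ (1 - alpha))%R%:E) `^ p) `^ p^-1
            + C%:E * (\int[@lebesgue_measure R]_(t in `[0%R, T])
                (\int[@lebesgue_measure R]_(s in `[0%R, t])
                  (enorm (g t s (x s) (u s) - g t s (x s) (u' s))%R)%:E)
                `^ p) `^ p^-1)%E].
Proof.
have q0 : 0 <= p^-1 by rewrite invr_ge0 ltW.
have N_ge0 (z : R -> 'rV[R]_n) : (0 <= N z)%E.
  by apply: integral_ge0 => t _; rewrite lee_fin powR_ge0.
split.
- move=> x0 u L0 au; exists (picard_limit x0 u);
  first exact: picard_limit_solution.
  by move=> y sy; exact: uniqueness (picard_limit_solution L0 au) sy.
- have [C C0 HC] := a_priori.
  exists (C `^ p^-1 * 2 `^ p^-1); first by rewrite mulr_ge0 ?powR_ge0.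
  move=> x0 u x L0 au sx; rewrite !LpV_normE//.
  apply: (@le_trans _ _ ((C%:E * (1 + N x0)) `^ p^-1)%E).
    apply: gt0_ler_poweR; first exact: q0.
    + by rewrite in_itv/= leey N_ge0.
    + rewrite in_itv/= leey andbT; apply: mule_ge0; first by rewrite lee_fin.
      exact: adde_ge0 lee01 (N_ge0 x0).
    + exact: HC L0 au sx.
  have N1 : (0 <= 1 + N x0)%E by exact: adde_ge0 lee01 (N_ge0 x0).
  rewrite poweRM; [|by rewrite lee_fin|exact: N1].
  have -> : (C `^ p^-1 * 2 `^ p^-1)%:E = ((C `^ p^-1)%:E * (2 `^ p^-1)%:E)%E.
    by rewrite [RHS]EFinM.
  rewrite poweR_EFin -[leRHS]muleA.
  apply: lee_wpmul2l; first by rewrite lee_fin powR_ge0.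
  apply: (le_trans (poweR_leD lee01 (N_ge0 x0) q0)).
  apply: lee_wpmul2l; first by rewrite lee_fin powR_ge0.
  rewrite poweR1r -[leLHS]adde0; apply: leeD; first exact: lexx.
  exact: Lnorm_ge0.
have [C C0 HC] := stability.
have C'0 : 0 <= C `^ p^-1 * (2 `^ p^-1 * 2 `^ p^-1) by rewrite !mulr_ge0
  ?powR_ge0.
exists (C `^ p^-1 * (2 `^ p^-1 * 2 `^ p^-1)); first exact: C'0.
move=> x0 x0' u u' x x' L0 L0' au au' sx sx'; rewrite !LpV_normE//.
have I0 (e : R -> \bar R) : (0 <= \int[mu]_(t in `[0%R, T]) (e t `^ p))%E.
  by apply: integral_ge0 => t _; exact: poweR_ge0.
have S0 := adde_ge0 (adde_ge0 (N_ge0 (fun t =>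
  x0 t - x0' t)) (I0 (control_gap_f x u u')))
  (I0 (control_gap_g x u u')).
apply: le_trans.
  apply: gt0_ler_poweR (HC x0 x0' u u' x x' L0 L0' au au' sx sx').
  - exact: q0.
  - by rewrite in_itv/= leey N_ge0.
  - by rewrite in_itv/= leey andbT; apply: mule_ge0;
    [rewrite lee_fin|exact: S0].
rewrite poweRM; [|by rewrite lee_fin|exact: S0].
apply: le_trans.
  apply: lee_wpmul2l; first by exact: poweR_ge0.
  exact: (poweR_root3_le q0 (N_ge0 _) (I0 _) (I0 _)).
rewrite poweR_EFin muleA -EFinM.
rewrite ge0_muleDr; [|by rewrite adde_ge0 ?poweR_ge0|exact: poweR_ge0].
by rewrite ge0_muleDr ?poweR_ge0.
Qed.

End picard_estimates.

Theorem lemmaB1 (R : realType) (n d : nat) (T p alpha : R)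
    (U : set 'rV[R]_d) (u0 : 'rV[R]_d)
    (f g : R -> R -> 'rV[R]_n -> 'rV[R]_d -> 'rV[R]_n) (K0 K : R -> R)
    (T_gt0 : 0 < T) (p_ge1 : 1 <= p) (alpha_gt0 : 0 < alpha)
    (alpha_lt1 : alpha < 1) (Uu0 : U u0)
    (mf : measurable_coef U T f) (mg : measurable_coef U T g)
    (K0_ge0 : forall s : R, s \in `[0, T] -> 0 <= K0 s)
    (K_ge0 : forall s : R, s \in `[0, T] -> 0 <= K s)
    (LK0 : in_Lplus T (maxe (p / (1 + alpha * p))%:E 1%:E) K0)
    (LK : in_Lplus T (maxe (alpha^-1)%:E (hoelder_conjugate p%:E)) K)
    (fg_lip : forall t s, triangle T (t, s) ->
      forall x x' u u', U u -> U u' ->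
      enorm (f t s x u - f t s x' u') + enorm (g t s x u - g t s x' u')
        <= K s * (enorm (x - x') + enorm (u - u')))
    (fg_bound : forall t s, triangle T (t, s) -> forall u, U u ->
      enorm (f t s 0 u) + enorm (g t s 0 u) <= K0 s) :
  [/\ forall x0 u, in_LpV T p x0 -> admissible_control U u0 T p u ->
        exists2 x, Lp_solution T p alpha f g x0 u x &
          forall y, Lp_solution T p alpha f g x0 u y ->
            {ae @lebesgue_measure R, forall t : R, t \in `[0, T] -> y t = x t},
      exists2 C : R, 0 <= C &
        forall x0 u x, in_LpV T p x0 -> admissible_control U u0 T p u ->
          Lp_solution T p alpha f g x0 u x ->
          (LpV_norm T p x <= C%:E * (1 + LpV_norm T p x0 +
             Lp_norm T p%:E (fun t => enorm (u t - u0)%R)))%E &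
      exists2 C : R, 0 <= C &
        forall x0 x0' u u' x x',
          in_LpV T p x0 -> in_LpV T p x0' ->
          admissible_control U u0 T p u -> admissible_control U u0 T p u' ->
          Lp_solution T p alpha f g x0 u x ->
          Lp_solution T p alpha f g x0' u' x' ->
          (LpV_norm T p (fun t => x t - x' t)%R
           <= C%:E * LpV_norm T p (fun t => x0 t - x0' t)%R
            + C%:E * (\int[@lebesgue_measure R]_(t in `[0%R, T])
                (\int[@lebesgue_measure R]_(s in `[0%R, t])
                  (enorm (f t s (x s) (u s) - f t s (x s) (u' s))
                   / (t - s) `^ (1 - alpha))%R%:E) `^ p) `^ p^-1
            + C%:E * (\int[@lebesgue_measure R]_(t in `[0%R, T])
                (\int[@lebesgue_measure R]_(s in `[0%R, t])
                  (enorm (g t s (x s) (u s) - g t s (x s) (u' s))%R)%:E)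
                `^ p) `^ p^-1)%E].
Proof.
exact: (well_posedness T_gt0 p_ge1 alpha_gt0 alpha_lt1 mf mg K0_ge0 K_ge0
  LK0 LK (measurable_in_Lplus LK0) (measurable_in_Lplus LK) fg_lip fg_bound).
Qed.
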